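(* Assume that $\Lambda=K\Gamma/I$ satisfies condition (N). Let $\mathbb S=(S(0),\dots,S(l))$ be a sequence of simple left $\Lambda$-modules with $V_{\mathbb S}\neq\varnothing$ and $\operatorname{Ext}^1_\Lambda(S(0),S(0))\neq 0$. Then the following conditions are equivalent: (1) There are only finitely many isomorphism types of uniserial left $\Lambda$-modules with composition series $\mathbb S$. (2) The unique path $p\in K\Gamma$ of length $l$ passing through the vertices corresponding to the simple modules $S(i)$ in the order prescribed by $\mathbb S$ has the following form: it starts with a power $\gamma^\mu$ of a loop $\gamma:e\to e$, followed by an arrow $\alpha:e\to e_1$ and then by arrows $e_1\to e_2\to\cdots\to e_\nu$, where $\mu,\nu\ge 0$, $\mu+\nu=l$, and $e\notin\{e_1,\dots,e_\nu\}$ (for $\nu=0$ this means $p=\gamma^\mu$); if $\mu\ge 1$ and $\nu\ge 2$, then $e_1\notin\{e_2,\dots,e_\nu\}$. Moreover, the only slack halyards on $p$ are of the form $(\alpha,\gamma^i)$ with $0\le i\le\mu-1$. If (2) is satisfied, and if there are no tight halyards on $p$, then there exists, up to isomorphism, precisely one uniserial left $\Lambda$-module with composition series $\mathbb S$.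
   Context: **Setting.** $K$ is an infinite field, $\Gamma$ a finite quiver, $I$ an admissible ideal of the path algebra $K\Gamma$, $\Lambda=K\Gamma/I$ (a finite dimensional split basic $K$-algebra), and $J$ its Jacobson radical. Vertices of $\Gamma$ are identified with the corresponding primitive idempotents of $\Lambda$. Paths are composed so that $qp$ means ''$q$ after $p$''; vertices are the paths of length $0$. A right subpath of a path $p$ is a path $u$ with $p=u'u$ in $K\Gamma$ for some path $u'$ (lengths $0$ allowed). Modules are finitely generated left modules. **Uniserial modules, masts.** A module is uniserial if its submodules form a chain. A uniserial module $U$ of composition length $l+1$ has composition series $\mathbb S=(S(0),\dots,S(l))$ if $J^iU/J^{i+1}U\cong S(i)$ for all $i$. A mast of $U$ is a path $p$ in $K\Gamma$ of length $l$ with $pU\neq 0$; a path is called a mast if it is a mast of some uniserial left $\Lambda$-module. A top element of $U$ is an element $x\in U\setminus JU$ with $x=ex$ for a vertex $e$. **Condition (N).** Whenever $\alpha:e\to e'$ is an arrow in $\Gamma$ and $p:e\to e'$ is a mast of positive length, then $p\in K\Gamma\alpha\cup\alpha K\Gamma$ (i.e. $p$ starts or ends with the arrow $\alpha$). Condition (N) implies that $\Gamma$ has no two distinct arrows with the same start and the same end. **Detours and $V_p$, $V_{\mathbb S}$.** Let $p$ be a path. A detour on $p$ is a pair $(\alpha,u)$ with $u$ a right subpath of $p$ and $\alpha$ an arrow such that $\alpha u$ is a path which is not a right subpath of $p$, but there is a right subpath of $p$ strictly longer than $u$ ending in the same vertex as $\alpha$. All right subpaths of $p$ that are longer than $u$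 and end in the same vertex as $\alpha$ are denoted $v_i(\alpha,u)$, $i\in I(\alpha,u)$. Let $D$ be the set of triples $(\alpha,u,i)$ with $(\alpha,u)$ a detour on $p$ and $i\in I(\alpha,u)$, with corresponding independent variables $X_i(\alpha,u)$. $V_p\subseteq K^D$ is the set of all points $k=(k_i(\alpha,u))$ for which there are a uniserial left $\Lambda$-module $U$ with mast $p$ and a top element $x$ of $U$ with $\alpha ux=\sum_{i\in I(\alpha,u)}k_i(\alpha,u)v_i(\alpha,u)x$ for all detours $(\alpha,u)$ on $p$; this set is known to be Zariski closed. $A_p$ is the coordinate ring of $V_p$, i.e. the polynomial ring in the $X_i(\alpha,u)$ modulo the ideal of polynomials vanishing on $V_p$. For a sequence $\mathbb S=(S(0),\dots,S(l))$ of simple modules, with corresponding vertices $e(0),\dots,e(l)$ (so $S(i)\cong\Lambda e(i)/Je(i)$), there is, under (N), at most one path $p$ of length $l$ through $e(0),\dots,e(l)$ in this order; $V_{\mathbb S}=V_p$ (empty if no such path exists). **Halyards.** Let $p$ be a mast. A detour $(\alpha,u)$ on $p$ is a halyard on $p$ if some $X_j(\alpha,u)$ has nonzero image in $A_p$ (equivalently, $\alpha ux\neq0$ for some uniserial module with mast $p$ and some top element $x$ of it). A variable $X_j(\alpha,u)$ of a halyard $(\alpha,u)$ is slack if its image in $A_p$ is transcendental over $K$ (equivalently, the coordinate $k_j(\alpha,u)$ takes infinitely many values on $V_p$). A halyard is slack if it has at least one slack variable, and tight otherwise. *)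

(* Defs.v *)
From HB Require Import structures.
From mathcomp Require Import all_boot all_order all_algebra.
From mathcomp Require Import boolp classical_sets cardinality.
From mathcomp Require Import finmap monalg.
Set Implicit Arguments.
Unset Strict Implicit.
Unset Printing Implicit Defensive.

Import GRing.Theory.

Local Open Scope ring_scope.
Local Open Scope quotient_scope.

(* An abstract submodClosed predicate is not registered as a zmodClosed one,
   which {quot _} and the subtype constructions need; in_sub N is. *)
Section SubmoduleZmod.
Variables (R : pzRingType) (V : lmodType R) (N : submodClosed V).

Definition in_sub : {pred V} := [pred x | x \in N].

Lemma in_sub_closed : GRing.subsemimod_closed in_sub.
Proof.
split=> [|a x Nx]; last exact: GRing.rpredZ.
by split=> [|x y Nx Ny]; [exact: (rpred0 N)|exact: (@rpredD _ N)].
Qed.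

HB.instance Definition _ :=
  GRing.isSubmodClosed.Build R V in_sub in_sub_closed.

End SubmoduleZmod.

HB.mixin Record isTwoSided (R : pzRingType) (I : R -> bool) := {
  ideal_mulr_subproof : forall a x, x \in I -> a * x \in I;
  ideal_mull_subproof : forall a x, x \in I -> x * a \in I
}.

(* Two-sided ideals, not necessarily proper. *)
#[short(type="ideal")]
HB.structure Definition Ideal (R : pzRingType) :=
  {I of GRing.ZmodClosed R I & isTwoSided R I}.

Section IdealTheory.
Variables (R : pzRingType) (I : ideal R).

Lemma idealMr (a x : R) : x \in I -> a * x \in I.
Proof. exact: ideal_mulr_subproof. Qed.

Lemma idealMl (a x : R) : x \in I -> x * a \in I.
Proof. exact: ideal_mull_subproof. Qed.

End IdealTheory.

Section QuotientModule.
Variables (R : pzRingType) (V : lmodType R) (N : submodClosed V).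

Definition lquot : Type := Quotient.quot (in_sub N).
HB.instance Definition _ := GRing.Zmodule.on lquot.
HB.instance Definition _ := EqQuotient.on lquot.

Definition lquot_scale (a : R) := lift_op1 lquot (GRing.scale a).

Lemma pi_lquotE (x y : V) :
  (\pi_lquot x = \pi_lquot y) <-> (x - y \in N).
Proof.
split=> [/eqP|h]; first by rewrite -(Quotient.idealrBE (in_sub N) x y).
by apply/eqP; rewrite -(Quotient.idealrBE (in_sub N) x y).
Qed.

Lemma pi_lquotD (x y : V) : \pi_lquot (x + y) = \pi_lquot x + \pi_lquot y.
Proof. exact: Quotient.pi_add. Qed.

Lemma pi_lquotZ a (x : V) : \pi_lquot (a *: x) = lquot_scale a (\pi_lquot x).
Proof.
rewrite /lquot_scale -lock; apply/pi_lquotE; rewrite -scalerBr GRing.rpredZ //.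
by apply/pi_lquotE; rewrite reprK.
Qed.

Lemma lquot_scaleA a b x :
  lquot_scale a (lquot_scale b x) = lquot_scale (a * b) x.
Proof.
by rewrite -[x]reprK -(pi_lquotZ b) -(pi_lquotZ a) -(pi_lquotZ (a * b)) scalerA.
Qed.

Lemma lquot_scale1 : left_id 1 lquot_scale.
Proof. by move=> x; rewrite -[x]reprK -pi_lquotZ scale1r. Qed.

Lemma lquot_scaleDr : right_distributive lquot_scale +%R.
Proof.
move=> a x y; rewrite -[x]reprK -[y]reprK.
rewrite -(pi_lquotZ a (repr x)) -(pi_lquotZ a (repr y)) -!pi_lquotD.
by rewrite -pi_lquotZ scalerDr.
Qed.

Lemma lquot_scaleDl x : {morph lquot_scale^~ x : a b / a + b}.
Proof.
move=> a b; rewrite -[x]reprK.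
by rewrite -(pi_lquotZ a) -(pi_lquotZ b) -(pi_lquotZ (a + b)) -pi_lquotD scalerDl.
Qed.

HB.instance Definition _ := GRing.Zmodule_isLmodule.Build R lquot
  lquot_scaleA lquot_scale1 lquot_scaleDr lquot_scaleDl.

Definition lproj (x : V) : lquot := \pi_lquot x.
Lemma lproj_linear : linear lproj.
Proof. by move=> a x y; rewrite /lproj pi_lquotD pi_lquotZ. Qed.
HB.instance Definition _ := GRing.isLinear.Build R V lquot _ lproj lproj_linear.

Lemma lproj_eq0 x : (lproj x = 0) <-> (x \in N).
Proof. by rewrite -(raddf0 lproj) pi_lquotE subr0. Qed.

Lemma lproj_surj y : exists x, y = lproj x.
Proof. by exists (repr y); rewrite /lproj reprK. Qed.

End QuotientModule.

Section QuotientRing.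
Variables (R : pzRingType) (I : ideal R).

Definition rquot : Type := Quotient.quot I.
HB.instance Definition _ := GRing.Zmodule.on rquot.
HB.instance Definition _ := EqQuotient.on rquot.

Definition rquot_one : rquot := \pi_rquot 1.
Definition rquot_mul := lift_op2 rquot *%R.

Lemma pi_rquotE (x y : R) : (\pi_rquot x = \pi_rquot y) <-> (x - y \in I).
Proof.
split=> [/eqP|h]; first by rewrite -(Quotient.idealrBE I x y).
by apply/eqP; rewrite -(Quotient.idealrBE I x y).
Qed.

Lemma pi_rquotD (x y : R) : \pi_rquot (x + y) = \pi_rquot x + \pi_rquot y.
Proof. exact: Quotient.pi_add. Qed.

Lemma pi_rquotM (x y : R) :
  \pi_rquot (x * y) = rquot_mul (\pi_rquot x) (\pi_rquot y).
Proof.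
rewrite /rquot_mul -lock; apply/pi_rquotE; set x' := repr _; set y' := repr _.
have -> : x * y - x' * y' = (x - x') * y + x' * (y - y').
  by rewrite mulrBl mulrBr addrA subrK.
rewrite rpredD //; first by apply: idealMl; apply/pi_rquotE; rewrite reprK.
by apply: idealMr; apply/pi_rquotE; rewrite reprK.
Qed.

Lemma rquot_mulA : associative rquot_mul.
Proof.
move=> x y z; rewrite -[x]reprK -[y]reprK -[z]reprK.
move: (repr x) (repr y) (repr z) => a b c.
by rewrite -(pi_rquotM b c) -(pi_rquotM a b) -(pi_rquotM a) -(pi_rquotM _ c) mulrA.
Qed.

Lemma rquot_mul1 : left_id rquot_one rquot_mul.
Proof. by move=> x; rewrite -[x]reprK -pi_rquotM mul1r. Qed.

Lemma rquot_1mul : right_id rquot_one rquot_mul.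
Proof. by move=> x; rewrite -[x]reprK -pi_rquotM mulr1. Qed.

Lemma rquot_mulDl : left_distributive rquot_mul +%R.
Proof.
move=> x y z; rewrite -[x]reprK -[y]reprK -[z]reprK.
move: (repr x) (repr y) (repr z) => a b c.
by rewrite -(pi_rquotM a c) -(pi_rquotM b c) -!pi_rquotD -(pi_rquotM _ c) mulrDl.
Qed.

Lemma rquot_mulDr : right_distributive rquot_mul +%R.
Proof.
move=> x y z; rewrite -[x]reprK -[y]reprK -[z]reprK.
move: (repr x) (repr y) (repr z) => a b c.
by rewrite -(pi_rquotM a b) -(pi_rquotM a c) -!pi_rquotD -(pi_rquotM a) mulrDr.
Qed.

HB.instance Definition _ := GRing.Zmodule_isPzRing.Build rquot
  rquot_mulA rquot_mul1 rquot_1mul rquot_mulDl rquot_mulDr.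

Definition rproj (x : R) : rquot := \pi_rquot x.
Lemma rproj_zmod_morphism : zmod_morphism rproj.
Proof. by move=> x y; rewrite /rproj pi_rquotD; congr (_ + _); exact: Quotient.pi_opp. Qed.
Lemma rproj_monoid_morphism : monoid_morphism rproj.
Proof. by split=> // x y; rewrite /rproj pi_rquotM. Qed.
HB.instance Definition _ :=
  GRing.isZmodMorphism.Build R rquot rproj rproj_zmod_morphism.
HB.instance Definition _ :=
  GRing.isMonoidMorphism.Build R rquot rproj rproj_monoid_morphism.

Lemma rproj_eq0 x : (rproj x = 0) <-> (x \in I).
Proof. by rewrite -(raddf0 rproj) pi_rquotE subr0. Qed.

Lemma rproj_surj y : exists x, y = rproj x.
Proof. by exists (repr y); rewrite /rproj reprK. Qed.

End QuotientRing.

Section ModuleTheory.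
Variables (R : pzRingType).
Implicit Types (V W : lmodType R).

Definition full_pred V : {pred V} := predT.
Lemma full_closed V : GRing.subsemimod_closed (@full_pred V).
Proof. by []. Qed.
HB.instance Definition _ V :=
  GRing.isSubmodClosed.Build R V (@full_pred V) (@full_closed V).
Definition full V : submodClosed V := @full_pred V.

Definition span_pred V (A : set V) : {pred V} :=
  [pred x | `[< forall N : submodClosed V,
                  (forall y, A y -> y \in N) -> x \in N >]].
Lemma span_closed V (A : set V) : GRing.subsemimod_closed (span_pred A).
Proof.
split=> [|a x /asboolP Sx]; first split=> [|x y /asboolP Sx /asboolP Sy].
- by apply/asboolP=> N _; exact: rpred0.
- by apply/asboolP=> N AN; rewrite rpredD ?Sx ?Sy.
- by apply/asboolP=> N AN; rewrite GRing.rpredZ ?Sx.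
Qed.
HB.instance Definition _ V (A : set V) :=
  GRing.isSubmodClosed.Build R V (span_pred A) (span_closed A).
Definition span V (A : set V) : submodClosed V := span_pred A.

Definition lsub V (N : submodClosed V) : Type := {x : V | x \in in_sub N}.
HB.instance Definition _ V (N : submodClosed V) := SubChoice.on (lsub N).
HB.instance Definition _ V (N : submodClosed V) :=
  [SubChoice_isSubLmodule of lsub N by <:].

Definition comap_pred V (N N' : submodClosed V) : {pred lsub N} :=
  [pred x | val x \in N'].
Lemma comap_closed V (N N' : submodClosed V) :
  GRing.subsemimod_closed (@comap_pred V N N').
Proof.
split=> [|a x Sx]; first split=> [|x y Sx Sy].
- by rewrite inE /= rpred0.
- by rewrite inE /= rpredD.
- by rewrite inE /= GRing.rpredZ.
Qed.
HB.instance Definition _ V (N N' : submodClosed V) :=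
  GRing.isSubmodClosed.Build R (lsub N) (@comap_pred V N N')
    (@comap_closed V N N').

(* The factor N / (N :&: N'); in all uses below N' is contained in N. *)
Definition subquot V (N N' : submodClosed V) : lmodType R :=
  lquot (@comap_pred V N N').

Definition isomorphic V W : Prop := exists f : {linear V -> W}, bijective f.

Definition simple V : Prop :=
  (exists x : V, x <> 0) /\
  forall N : submodClosed V, (forall x, x \in N -> x = 0) \/ (forall x, x \in N).

Definition finitely_generated V : Prop :=
  exists n (g : 'I_n -> V), forall x, exists c : 'I_n -> R,
    x = \sum_i c i *: g i.

Definition uniserial V : Prop :=
  forall N N' : submodClosed V, {subset N <= N'} \/ {subset N' <= N}.

Definition has_length V (n : nat) : Prop :=
  exists N : nat -> submodClosed V,
    [/\ forall x, x \in N 0, forall x, x \in N n -> x = 0 &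
        forall i, (i < n)%N ->
          {subset N i.+1 <= N i} /\ simple (subquot (N i) (N i.+1))].

Definition maximal_left_ideal (m : submodClosed R^o) : Prop :=
  (exists x, x \notin m) /\
  forall N : submodClosed R^o, {subset m <= N} ->
    {subset N <= m} \/ (forall x, x \in N).

Definition jacobson_pred : {pred R^o} :=
  [pred x | `[< forall m, maximal_left_ideal m -> x \in m >]].
Lemma jacobson_closed : GRing.subsemimod_closed jacobson_pred.
Proof.
split=> [|a x /asboolP Sx]; first split=> [|x y /asboolP Sx /asboolP Sy].
- by apply/asboolP=> m _; exact: rpred0.
- by apply/asboolP=> m mm; rewrite rpredD ?Sx ?Sy.
- by apply/asboolP=> m mm; rewrite GRing.rpredZ ?Sx.
Qed.
HB.instance Definition _ :=
  GRing.isSubmodClosed.Build R R^o jacobson_pred jacobson_closed.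
Definition jacobson : submodClosed R^o := jacobson_pred.

Fixpoint radpow V (i : nat) : submodClosed V :=
  if i is i'.+1
  then span [set y | exists a x, [/\ a \in jacobson, x \in radpow V i' & y = a *: x]]
  else full V.

(* N e = {a e | a in N}, for a left ideal N. *)
Definition rmul_pred (N : submodClosed R^o) (e : R) : {pred R^o} :=
  [pred x | `[< exists2 a : R, a \in N & x = a * e >]].
Lemma rmul_closed N e : GRing.subsemimod_closed (rmul_pred N e).
Proof.
split; first split.
- by apply/asboolP; exists 0; [exact: (rpred0 N)|rewrite mul0r].
- move=> x y /asboolP [a Na ->] /asboolP [b Nb ->]; apply/asboolP.
  by exists (a + b); [exact: (@rpredD _ N)|rewrite mulrDl].
- move=> c x /asboolP [a Na ->]; apply/asboolP.
  exists (c * a); last by rewrite -mulrA.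
  exact: (@GRing.rpredZ _ _ N).
Qed.
HB.instance Definition _ N e :=
  GRing.isSubmodClosed.Build R R^o (rmul_pred N e) (@rmul_closed N e).
Definition rmul N e : submodClosed R^o := rmul_pred N e.

Definition has_series (l : nat) (S : 'I_l.+1 -> lmodType R) V : Prop :=
  [/\ finitely_generated V, uniserial V, has_length V l.+1 &
      forall i : 'I_l.+1,
        isomorphic (subquot (radpow V i) (radpow V i.+1)) (S i)].

(* Yoneda extensions 0 -> W -> E -> V -> 0; the classes for ext_equiv are the
   elements of Ext^1(V, W), with zero the class of the split extension. *)
Record extension V W := Extension {
  ext_mid : lmodType R;
  ext_inj : {linear W -> ext_mid};
  ext_proj : {linear ext_mid -> V};
  ext_injP : injective ext_inj;
  ext_projP : forall v, exists x, ext_proj x = v;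
  ext_exact : forall x, ext_proj x = 0 <-> exists w, x = ext_inj w
}.

Definition ext_equiv V W (E F : extension V W) : Prop :=
  exists f : {linear ext_mid E -> ext_mid F},
    (forall w, f (ext_inj E w) = ext_inj F w) /\
    (forall x, ext_proj F (f x) = ext_proj E x).

Section SplitExtension.
Variables V W : lmodType R.

Definition split_inj (w : W) : (W * V)%type := (w, 0).
Lemma split_inj_linear : linear split_inj.
Proof. by move=> a x y; rewrite -[RHS]/(a *: x + y, a *: 0 + 0) scaler0 addr0. Qed.
HB.instance Definition _ :=
  GRing.isLinear.Build R W (W * V)%type _ split_inj split_inj_linear.

Definition split_proj (x : (W * V)%type) : V := x.2.
Lemma split_proj_linear : linear split_proj. Proof. by []. Qed.
HB.instance Definition _ :=
  GRing.isLinear.Build R (W * V)%type V _ split_proj split_proj_linear.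

Lemma split_inj_injective : injective split_inj.
Proof. by move=> x y []. Qed.
Lemma split_proj_surj v : exists x, split_proj x = v.
Proof. by exists (0, v). Qed.
Lemma split_exact x : split_proj x = 0 <-> exists w, x = split_inj w.
Proof.
by case: x => w v; split=> [/= ->|[w' [_ ->]]] //; exists w.
Qed.

Definition split_extension : extension V W :=
  Extension split_inj_injective split_proj_surj split_exact.

End SplitExtension.

Definition Ext1_neq0 V W : Prop :=
  exists E : extension V W, ~ ext_equiv E (split_extension V W).

End ModuleTheory.

Record quiver : Type := Quiver {
  vertex : finType;
  arrow : finType;
  src : arrow -> vertex;
  tgt : arrow -> vertex
}.

Section Paths.
Variable Q : quiver.

Fixpoint walk (v : vertex Q) (s : seq (arrow Q)) : bool :=
  if s is a :: s' then (src a == v) && walk (tgt a) s' else true.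

(* A path is its start vertex together with its arrows in the order in which
   they are traversed; hence the product [q p], which is q after p, has the
   arrow list of p followed by that of q, and the right subpaths of p
   correspond to the prefixes of its arrow list. *)
Definition qpath : Type := {x : vertex Q * seq (arrow Q) | walk x.1 x.2}.
HB.instance Definition _ := Countable.on qpath.
HB.instance Definition _ := SubType.on qpath.

Implicit Types p q r u : qpath.

Definition pstart p : vertex Q := (val p).1.
Definition parrows p : seq (arrow Q) := (val p).2.
Definition plen p : nat := size (parrows p).
Definition wend (v : vertex Q) (s : seq (arrow Q)) : vertex Q :=
  last v (map (@tgt Q) s).
Definition pend p : vertex Q := wend (pstart p) (parrows p).
(* The (i+1)-st vertex visited by p. *)
Definition pvertex p (i : nat) : vertex Q :=
  wend (pstart p) (take i (parrows p)).

Definition vpath (e : vertex Q) : qpath := exist _ (e, [::]) isT.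

Lemma apath_subproof (a : arrow Q) : walk (src a) [:: a].
Proof. by rewrite /= eqxx. Qed.
Definition apath (a : arrow Q) : qpath := exist _ (src a, [:: a]) (apath_subproof a).

Lemma walk_cat v s t : walk v (s ++ t) = walk v s && walk (wend v s) t.
Proof. by elim: s v => //= a s IHs v; rewrite IHs andbA. Qed.

Lemma wend_cat v s t : wend v (s ++ t) = wend (wend v s) t.
Proof. by rewrite /wend map_cat last_cat. Qed.

Lemma ptake_subproof (i : nat) p : walk (pstart p) (take i (parrows p)).
Proof.
have := valP p; rewrite -/(pstart p) -/(parrows p) -{1}(cat_take_drop i (parrows p)).
by rewrite walk_cat => /andP[].
Qed.
Definition ptake (i : nat) p : qpath :=
  exist _ (pstart p, take i (parrows p)) (ptake_subproof i p).

Definition pcomp q p : option qpath :=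
  if pend p == pstart q then insub (pstart p, parrows p ++ parrows q) else None.

Lemma pcompP q p r :
  pcomp q p = Some r <->
  pend p = pstart q /\ val r = (pstart p, parrows p ++ parrows q).
Proof.
rewrite /pcomp; split.
  by case: eqP => // pq; case: insubP => //= r' _ r'E [<-].
move=> [-> rE]; rewrite eqxx; have := valP r; rewrite rE => rw.
by rewrite insubT; congr Some; apply: val_inj; rewrite rE.
Qed.

Lemma pcompN q p : pcomp q p = None -> pend p <> pstart q.
Proof.
rewrite /pcomp; case: eqP => // pq; case: insubP => //= /negP[].
have := valP p; rewrite walk_cat -/(pstart p) -/(parrows p) => ->.
by rewrite -/(pend p) pq; have := valP q.
Qed.

Definition right_subpath u p : bool :=
  (pstart u == pstart p) && prefix (parrows u) (parrows p).

Definition detour p (a : arrow Q) u : bool :=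
  [&& right_subpath u p,
      (if pcomp (apath a) u is Some w then ~~ right_subpath w p else false) &
      [exists j : 'I_(plen p).+1, (plen u < j)%N && (pend (ptake j p) == tgt a)]].

(* The triples (alpha, u, i); the right subpaths u and v_i are encoded by
   their lengths. *)
Definition detour_index p : Type :=
  {t : arrow Q * 'I_(plen p).+1 * 'I_(plen p).+1 |
    [&& detour p t.1.1 (ptake t.1.2 p), (t.1.2 < t.2)%N &
        pend (ptake t.2 p) == tgt t.1.1]}.
HB.instance Definition _ p := Finite.on (detour_index p).

Definition darrow p (d : detour_index p) : arrow Q := (val d).1.1.
Definition dsub p (d : detour_index p) : qpath := ptake (val d).1.2 p.
Definition dlong p (d : detour_index p) : qpath := ptake (val d).2 p.

End Paths.

(* The vector space structure is that of {malg K[qpath Q]}; its operations are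
   sealed because unification otherwise unfolds them down to finite maps. *)
Definition path_algebra (K : fieldType) (Q : quiver) : Type := {malg K[qpath Q]}.
HB.instance Definition _ K Q := Choice.on (path_algebra K Q).

HB.lock Definition pa_add (K : fieldType) (Q : quiver) (f g : path_algebra K Q) : path_algebra K Q :=
  (f : {malg K[qpath Q]}) + g.
HB.lock Definition pa_opp (K : fieldType) (Q : quiver) (f : path_algebra K Q) : path_algebra K Q :=
  - (f : {malg K[qpath Q]}).
HB.lock Definition pa_scale (K : fieldType) (Q : quiver) (c : K) (f : path_algebra K Q) :
  path_algebra K Q := c *: (f : {malg K[qpath Q]}).
HB.lock Definition pa_zero (K : fieldType) (Q : quiver) : path_algebra K Q := (0 : {malg K[qpath Q]}).

HB.lock Definition bpath (K : fieldType) (Q : quiver) (p : qpath Q) :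
  path_algebra K Q := << p >>.

Section PathAlgebra.
Variables (K : fieldType) (Q : quiver).
Local Notation path_algebra := (path_algebra K Q).
Local Notation bpath := (@bpath K Q).

Lemma pa_addA : associative (@pa_add K Q).
Proof. by move=> f g h; rewrite !pa_add.unlock addrA. Qed.
Lemma pa_addC : commutative (@pa_add K Q).
Proof. by move=> f g; rewrite !pa_add.unlock addrC. Qed.
Lemma pa_add0 : left_id (@pa_zero K Q) (@pa_add K Q).
Proof. by move=> f; rewrite pa_add.unlock pa_zero.unlock add0r. Qed.
Lemma pa_addN : left_inverse (@pa_zero K Q) (@pa_opp K Q) (@pa_add K Q).
Proof. by move=> f; rewrite pa_add.unlock pa_opp.unlock pa_zero.unlock addNr. Qed.
HB.instance Definition _ :=
  GRing.isZmodule.Build path_algebra pa_addA pa_addC pa_add0 pa_addN.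

Lemma pa_scaleA a b (f : path_algebra) :
  pa_scale a (pa_scale b f) = pa_scale (a * b) f.
Proof. by rewrite !pa_scale.unlock scalerA. Qed.
Lemma pa_scale1 : left_id 1 (@pa_scale K Q).
Proof. by move=> f; rewrite pa_scale.unlock scale1r. Qed.
Lemma pa_scaleDr : right_distributive (@pa_scale K Q) +%R.
Proof.
by move=> c f g; rewrite /GRing.add /= !pa_add.unlock !pa_scale.unlock scalerDr.
Qed.
Lemma pa_scaleDl (f : path_algebra) : {morph (@pa_scale K Q)^~ f : a b / a + b}.
Proof.
move=> a b; rewrite [RHS]/GRing.add /= pa_add.unlock !pa_scale.unlock.
exact: scalerDl.
Qed.
HB.instance Definition _ := GRing.Zmodule_isLmodule.Build K path_algebra
  pa_scaleA pa_scale1 pa_scaleDr pa_scaleDl.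

Definition pcoef (p : qpath Q) (f : path_algebra) : K := mcoeff p f.

Lemma pcoefP (f g : path_algebra) : (forall p, pcoef p f = pcoef p g) -> f = g.
Proof. by move=> fg; apply/malgP. Qed.
Lemma pcoef0 p : pcoef p 0 = 0.
Proof. by rewrite /pcoef /GRing.zero /= pa_zero.unlock mcoeff0. Qed.
Lemma pcoefD p f g : pcoef p (f + g) = pcoef p f + pcoef p g.
Proof. by rewrite /pcoef [f + g]/GRing.add /= pa_add.unlock mcoeffD. Qed.
Lemma pcoefZ p c f : pcoef p (c *: f) = c * pcoef p f.
Proof. by rewrite /pcoef [c *: f]/GRing.scale /= pa_scale.unlock mcoeffZ. Qed.
Lemma pcoefU p q : pcoef p (bpath q) = (q == p)%:R.
Proof. by rewrite /pcoef bpath.unlock mcoeffU. Qed.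
Lemma pcoef_sum p (I : Type) (r : seq I) (F : I -> path_algebra) :
  pcoef p (\sum_(i <- r) F i) = \sum_(i <- r) pcoef p (F i).
Proof. exact: (big_morph _ (pcoefD p) (pcoef0 p)). Qed.

Lemma pcoef_out (f : path_algebra) p : p \notin msupp f -> pcoef p f = 0.
Proof. exact: mcoeff_outdom. Qed.
Lemma psuppD (f g : path_algebra) : (msupp (f + g) `<=` msupp f `|` msupp g)%fset.
Proof. by rewrite [f + g]/GRing.add /= pa_add.unlock msuppD_le. Qed.
Lemma psuppZ c (f : path_algebra) : (msupp (c *: f) `<=` msupp f)%fset.
Proof. by rewrite [c *: f]/GRing.scale /= pa_scale.unlock msuppZ_le. Qed.
Lemma psuppU p : (msupp (bpath p) `<=` [fset p])%fset.
Proof. by rewrite bpath.unlock msuppU_le. Qed.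

Lemma path_algebraE (f : path_algebra) :
  f = \sum_(p <- msupp f) pcoef p f *: bpath p.
Proof.
apply: pcoefP => q; rewrite pcoef_sum.
case: (boolP (q \in msupp f)) => [qf|qf].
  rewrite (big_fsetD1 q) //= pcoefZ pcoefU eqxx mulr1 big1_fset ?addr0 // => p.
  by rewrite in_fsetD1 => /andP[/negPf pq _] _; rewrite pcoefZ pcoefU pq mulr0.
rewrite (pcoef_out qf) big_seq big1 // => p pf; rewrite pcoefZ pcoefU.
by case: eqP qf => [<-|_ _]; rewrite ?pf ?mulr0.
Qed.

Definition pmul (q p : qpath Q) : path_algebra :=
  if pcomp q p is Some r then bpath r else 0.

Definition pa_one : path_algebra := \sum_e bpath (vpath e).
Definition pa_mul (f g : path_algebra) : path_algebra :=
  \sum_(q <- msupp f) \sum_(p <- msupp g) (pcoef q f * pcoef p g) *: pmul q p.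

Lemma pa_mulw (A B : {fset qpath Q}) (f g : path_algebra) :
  (msupp f `<=` A)%fset -> (msupp g `<=` B)%fset ->
  pa_mul f g =
  \sum_(q <- A) \sum_(p <- B) (pcoef q f * pcoef p g) *: pmul q p.
Proof.
move=> fA gB; rewrite /pa_mul (big_fset_incl _ fA) /=.
  apply: eq_bigr => q _; apply: big_fset_incl => // p _ /pcoef_out ->.
  by rewrite mulr0 scale0r.
move=> q _ /pcoef_out fq.
by rewrite big1 // => p _; rewrite fq mul0r scale0r.
Qed.

Lemma pa_mulDl : left_distributive pa_mul +%R.
Proof.
move=> f1 f2 g; pose A := (msupp f1 `|` msupp f2)%fset.
rewrite (@pa_mulw A (msupp g)) ?psuppD ?fsubset_refl //.
rewrite (@pa_mulw A (msupp g) f1) ?fsubsetUl ?fsubset_refl //.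
rewrite (@pa_mulw A (msupp g) f2) ?fsubsetUr ?fsubset_refl //.
rewrite -big_split; apply: eq_bigr => q _ /=.
rewrite -big_split; apply: eq_bigr => p _ /=.
by rewrite pcoefD mulrDl scalerDl.
Qed.

Lemma pa_mulDr : right_distributive pa_mul +%R.
Proof.
move=> f g1 g2; pose B := (msupp g1 `|` msupp g2)%fset.
rewrite (@pa_mulw (msupp f) B) ?psuppD ?fsubset_refl //.
rewrite (@pa_mulw (msupp f) B f g1) ?fsubsetUl ?fsubset_refl //.
rewrite (@pa_mulw (msupp f) B f g2) ?fsubsetUr ?fsubset_refl //.
rewrite -big_split; apply: eq_bigr => q _ /=.
rewrite -big_split; apply: eq_bigr => p _ /=.
by rewrite pcoefD mulrDr scalerDl.
Qed.

Lemma pa_mulZl c f g : pa_mul (c *: f) g = c *: pa_mul f g.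
Proof.
rewrite (@pa_mulw (msupp f) (msupp g)) ?psuppZ ?fsubset_refl //.
rewrite scaler_sumr; apply: eq_bigr => q _.
rewrite scaler_sumr; apply: eq_bigr => p _.
by rewrite pcoefZ scalerA mulrA.
Qed.

Lemma pa_mulZr c f g : pa_mul f (c *: g) = c *: pa_mul f g.
Proof.
rewrite (@pa_mulw (msupp f) (msupp g)) ?psuppZ ?fsubset_refl //.
rewrite scaler_sumr; apply: eq_bigr => q _.
rewrite scaler_sumr; apply: eq_bigr => p _.
by rewrite pcoefZ scalerA mulrCA.
Qed.

Lemma pa_mulU q p : pa_mul (bpath q) (bpath p) = pmul q p.
Proof.
rewrite (@pa_mulw [fset q]%fset [fset p]%fset) ?psuppU //.
by rewrite !big_seq_fset1 !pcoefU !eqxx mulr1 scale1r.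
Qed.

Lemma pa_mul0l g : pa_mul 0 g = 0.
Proof. by rewrite -(scale0r (0 : path_algebra)) pa_mulZl !scale0r. Qed.

Lemma pa_mul0r f : pa_mul f 0 = 0.
Proof. by rewrite -(scale0r (0 : path_algebra)) pa_mulZr !scale0r. Qed.

Lemma pa_ind (P : path_algebra -> Prop) :
  P 0 -> (forall f g, P f -> P g -> P (f + g)) ->
  (forall c f, P f -> P (c *: f)) -> (forall p, P (bpath p)) ->
  forall f, P f.
Proof.
move=> P0 PD PZ PU f; rewrite (path_algebraE f).
by apply: big_ind => // p _; apply: PZ.
Qed.

Lemma pmulA q p r :
  pa_mul (bpath q) (pmul p r) = pa_mul (pmul q p) (bpath r).
Proof.
rewrite /pmul.
case E1: (pcomp p r) => [s|]; case E2: (pcomp q p) => [t|].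
- move/pcompP: E1 => [E1 sE]; move/pcompP: E2 => [E2 tE].
  have st : pstart s = pstart r by rewrite /pstart sE.
  have sa : parrows s = parrows r ++ parrows p by rewrite /parrows sE.
  have tt : pstart t = pstart p by rewrite /pstart tE.
  have ta : parrows t = parrows p ++ parrows q by rewrite /parrows tE.
  have se : pend s = pend p by rewrite /pend st sa wend_cat -/(pend r) E1.
  rewrite (pa_mulU q s) (pa_mulU t r) /pmul.
  suff -> : pcomp q s = pcomp t r by [].
  by rewrite /pcomp se E2 eqxx st sa tt ta E1 eqxx catA.
- move/pcompP: E1 => [E1 sE]; move/pcompN: E2 => E2.
  have st : pstart s = pstart r by rewrite /pstart sE.
  have sa : parrows s = parrows r ++ parrows p by rewrite /parrows sE.
  have se : pend s = pend p by rewrite /pend st sa wend_cat -/(pend r) E1.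
  by rewrite (pa_mulU q s) (pa_mul0l (bpath r)) /pmul /pcomp se; case: eqP.
- move/pcompN: E1 => E1; move/pcompP: E2 => [E2 tE].
  have tt : pstart t = pstart p by rewrite /pstart tE.
  by rewrite (pa_mulU t r) (pa_mul0r (bpath q)) /pmul /pcomp tt; case: eqP.
- by rewrite (pa_mul0r (bpath q)) (pa_mul0l (bpath r)).
Qed.

Lemma pa_mulA : associative pa_mul.
Proof.
move=> f g h; elim/pa_ind: f => [|f f' Hf Hf'|c f Hf|q].
- by rewrite (pa_mul0l g) (pa_mul0l h) (pa_mul0l (pa_mul g h)).
- by rewrite (pa_mulDl f f' g) (pa_mulDl _ _ h) (pa_mulDl f f') Hf Hf'.
- by rewrite (pa_mulZl c f g) (pa_mulZl c _ h) (pa_mulZl c f) Hf.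
elim/pa_ind: g => [|g g' Hg Hg'|c g Hg|p].
- by rewrite (pa_mul0l h) (pa_mul0r (bpath q)) (pa_mul0l h).
- rewrite (pa_mulDl g g' h) (pa_mulDr (bpath q) g g') (pa_mulDl _ _ h).
  by rewrite (pa_mulDr (bpath q)) Hg Hg'.
- rewrite (pa_mulZl c g h) (pa_mulZr c (bpath q) g) (pa_mulZl c _ h).
  by rewrite (pa_mulZr c (bpath q)) Hg.
elim/pa_ind: h => [|h h' Hh Hh'|c h Hh|r].
- by rewrite (pa_mul0r (bpath p)) (pa_mul0r (bpath q)) (pa_mul0r (pa_mul _ _)).
- rewrite (pa_mulDr (bpath p) h h') (pa_mulDr (bpath q)).
  by rewrite (pa_mulDr (pa_mul _ _)) Hh Hh'.
- rewrite (pa_mulZr c (bpath p) h) (pa_mulZr c (bpath q)).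
  by rewrite (pa_mulZr c (pa_mul _ _)) Hh.
by rewrite (pa_mulU p r) (pa_mulU q p) pmulA.
Qed.

Lemma pa_mul1 : left_id pa_one pa_mul.
Proof.
elim/pa_ind => [|f g Hf Hg|c f Hf|p].
- exact: pa_mul0r.
- by rewrite (pa_mulDr pa_one f g) Hf Hg.
- by rewrite (pa_mulZr c pa_one f) Hf.
rewrite /pa_one (big_morph (pa_mul^~ (bpath p)) (fun f g => pa_mulDl f g _) (pa_mul0l _)).
rewrite (bigD1 (pend p)) //= big1 ?addr0; last first.
  by move=> e ne; rewrite pa_mulU /pmul /pcomp eq_sym (negPf ne).
rewrite pa_mulU /pmul; case E: pcomp => [r|]; last by move/pcompN: E.
move/pcompP: E => [_ rE]; congr bpath; apply: val_inj.
by rewrite rE cats0 /pstart /parrows; case: (val p).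
Qed.

Lemma pa_1mul : right_id pa_one pa_mul.
Proof.
elim/pa_ind => [|f g Hf Hg|c f Hf|p].
- exact: pa_mul0l.
- by rewrite (pa_mulDl f g pa_one) Hf Hg.
- by rewrite (pa_mulZl c f pa_one) Hf.
rewrite /pa_one (big_morph (pa_mul (bpath p)) (fun f g => pa_mulDr _ f g) (pa_mul0r _)).
rewrite (bigD1 (pstart p)) //= big1 ?addr0; last first.
  by move=> e ne; rewrite pa_mulU /pmul /pcomp (negPf ne).
rewrite pa_mulU /pmul; case E: pcomp => [r|]; last by move/pcompN: E.
move/pcompP: E => [_ rE]; congr bpath; apply: val_inj.
by rewrite rE; exact/esym/surjective_pairing.
Qed.

HB.instance Definition _ := GRing.Zmodule_isPzRing.Build path_algebra
  pa_mulA pa_mul1 pa_1mul pa_mulDl pa_mulDr.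

Lemma bpathM q p : bpath q * bpath p = pmul q p.
Proof. exact: pa_mulU. Qed.

End PathAlgebra.

From mathcomp Require Import mpoly.

Section Uniserial.
Variables (K : fieldType) (Q : quiver).
Local Notation KQ := (path_algebra K Q).
Variable I : ideal KQ.

(* The n-th power of the ideal generated by the arrows is the span of the paths
   of length at least n. *)
Definition arrow_ideal_pow (n : nat) (f : KQ) : Prop :=
  forall p, pcoef p f <> 0 -> (n <= plen p)%N.

Definition admissible : Prop :=
  (forall f, f \in I -> arrow_ideal_pow 2 f) /\
  exists2 m, (2 <= m)%N & forall f, arrow_ideal_pow m f -> f \in I.

(* K acts on Lambda-modules through the elements [c *: 1]L. *)
Definition Lambda : pzRingType := rquot I.

Definition to_Lambda (f : KQ) : Lambda := rproj I f.
Local Notation "[ f ]L" := (to_Lambda f) (format "[ f ]L").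

Definition Svertex (e : vertex Q) : lmodType Lambda :=
  subquot (rmul (full Lambda^o) [bpath K (vpath e)]L)
          (rmul (jacobson Lambda) [bpath K (vpath e)]L).

Definition mast_of (p : qpath Q) (U : lmodType Lambda) : Prop :=
  [/\ finitely_generated U, uniserial U, has_length U (plen p).+1 &
      exists x : U, [bpath K p]L *: x <> 0].

Definition mast (p : qpath Q) : Prop :=
  exists U : lmodType Lambda, mast_of p U.

Definition top_element (U : lmodType Lambda) (x : U) : Prop :=
  x \notin radpow U 1 /\ exists e, x = [bpath K (vpath e)]L *: x.

Definition conditionN : Prop :=
  forall (a : arrow Q) (p : qpath Q),
    mast p -> (0 < plen p)%N -> pstart p = src a -> pend p = tgt a ->
    (exists w : KQ, bpath K p = w * bpath K (apath a)) \/
    (exists w : KQ, bpath K p = bpath K (apath a) * w).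

Definition Vp (p : qpath Q) : set {ffun detour_index p -> K} :=
  [set k | exists (U : lmodType Lambda) (x : U),
    [/\ mast_of p U, top_element x &
      forall (a : arrow Q) (u : qpath Q), detour p a u ->
        [bpath K (apath a) * bpath K u]L *: x =
        \sum_(d | (darrow d == a) && (dsub d == u))
          [k d *: bpath K (dlong d)]L *: x]].

Arguments Vp p _ : clear implicits.

(* The variable X_i(alpha,u) is 'X_(enum_rank d) for d = (alpha, u, i). *)
Local Notation coord_poly p := {mpoly K[#|{: detour_index p}|]}.

Definition vanishing_pred (p : qpath Q) : {pred coord_poly p} :=
  [pred f | `[< forall k, Vp p k -> f.@[fun i => k (enum_val i)] = 0 >]].

Lemma vanishing_zmod_closed p : zmod_closed (@vanishing_pred p).
Proof.
split=> [|f g /asboolP f0 /asboolP g0]; apply/asboolP=> k Vk.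
  by rewrite meval0.
by rewrite mevalB f0 ?g0 ?subr0.
Qed.
Lemma vanishing_mulr p (f g : coord_poly p) :
  g \in @vanishing_pred p -> f * g \in @vanishing_pred p.
Proof.
by move=> /asboolP g0; apply/asboolP=> k Vk; rewrite mevalM g0 // mulr0.
Qed.
Lemma vanishing_mull p (f g : coord_poly p) :
  g \in @vanishing_pred p -> g * f \in @vanishing_pred p.
Proof. by rewrite mulrC; exact: vanishing_mulr. Qed.
HB.instance Definition _ p :=
  GRing.isZmodClosed.Build (coord_poly p) (@vanishing_pred p)
    (@vanishing_zmod_closed p).
HB.instance Definition _ p :=
  isTwoSided.Build (coord_poly p) (@vanishing_pred p)
    (@vanishing_mulr p) (@vanishing_mull p).
Definition vanishing_ideal (p : qpath Q) : ideal (coord_poly p) :=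
  @vanishing_pred p.

Definition coord_ring (p : qpath Q) : pzRingType := rquot (vanishing_ideal p).

Definition coord_image (p : qpath Q) (f : coord_poly p) : coord_ring p :=
  rproj (vanishing_ideal p) f.

Definition dvar (p : qpath Q) (d : detour_index p) : coord_poly p :=
  'X_(enum_rank d).

Definition is_var_of (p : qpath Q) (a : arrow Q) (u : qpath Q)
    (d : detour_index p) : Prop := darrow d = a /\ dsub d = u.

Definition halyard (p : qpath Q) (a : arrow Q) (u : qpath Q) : Prop :=
  detour p a u /\
  exists d : detour_index p, is_var_of a u d /\ coord_image (dvar d) <> 0.

Definition slack_variable (p : qpath Q) (d : detour_index p) : Prop :=
  forall f : {poly K}, f != 0 ->
    coord_image (map_poly (fun c : K => c%:MP_[#|{: detour_index p}|]) f).[dvar d] <> 0.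

Definition slack_halyard (p : qpath Q) (a : arrow Q) (u : qpath Q) : Prop :=
  halyard p a u /\
  exists d : detour_index p, is_var_of a u d /\ slack_variable d.

Definition tight_halyard (p : qpath Q) (a : arrow Q) (u : qpath Q) : Prop :=
  halyard p a u /\ ~ slack_halyard p a u.

Variables (l : nat) (S : 'I_l.+1 -> lmodType Lambda).

Definition path_through (p : qpath Q) : Prop :=
  plen p = l /\ forall i : 'I_l.+1, isomorphic (S i) (Svertex (pvertex p i)).

(* Condition (N) leaves at most one path p with path_through p, so this is V_p
   for that p, and empty if there is none. *)
Definition VS : set {p : qpath Q & {ffun detour_index p -> K}} :=
  [set t | path_through (tag t) /\ Vp (tag t) (tagged t)].

Definition finitely_many_uniserials : Prop :=
  exists n (M : 'I_n -> lmodType Lambda),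
    forall U : lmodType Lambda, has_series S U -> exists i, isomorphic U (M i).

Definition unique_uniserial : Prop :=
  exists2 U : lmodType Lambda, has_series S U &
    forall U' : lmodType Lambda, has_series S U' -> isomorphic U' U.

(* p = s g^mu, where s traverses the arrows e -> e_1 -> ... -> e_nu and
   [seq tgt a | a <- s] = [:: e_1; ...; e_nu]. *)
Definition loop_then_leave (p : qpath Q) (g : arrow Q) (mu : nat)
    (s : seq (arrow Q)) : Prop :=
  [/\ src g = pstart p, tgt g = pstart p, parrows p = nseq mu g ++ s,
      pstart p \notin map (@tgt Q) s &
      forall a s', s = a :: s' -> (0 < mu)%N -> (0 < size s')%N ->
        tgt a \notin map (@tgt Q) s'].

Definition condition2 : Prop :=
  exists p, unique path_through p /\
  exists g mu s, loop_then_leave p g mu s /\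
    forall a u, slack_halyard p a u ->
      exists i, [/\ (i < mu)%N, ohead s = Some a,
                    pstart u = pstart p & parrows u = nseq i g].

End Uniserial.

(* Main.v *)
(* If U is uniserial with mast p and top element x, the vectors v x, for v a
   right subpath of p, form a basis of U adapted to the radical filtration, and
   the coordinates k of the vectors (alpha u) x, for (alpha, u) a detour on p,
   determine U.

   The nonvanishing of Ext^1(S(0), S(0)) provides a loop gamma at e = e(0), and
   (N), applied to subpaths of p, forces p = s gamma^mu where s never returns to
   e, nor to e_1 after its first arrow alpha if mu > 0.  Hence the top elements
   of U are the c_0 x + sum_(1 <= i <= mu) c_i gamma^i x with c_0 <> 0, and
   gamma^(mu+1) x = 0.  A change of top element does not affect the coordinates
   of the detours (beta, u) with u of length >= mu, so these are isomorphism
   invariants and cannot be slack if there are finitely many modules.  By (N),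
   the remaining detours are the (alpha, gamma^i) with i < mu, for which
   alpha gamma^i x is a multiple of alpha gamma^mu x; a suitable change of top
   element makes all of their coordinates vanish.  So if no other halyard is
   slack, then each module is given by one of finitely many points k, and by
   k = 0 if no other halyard exists at all. *)

Require Import Defs.
From HB Require Import structures.
From mathcomp Require Import all_boot all_order all_algebra.
From mathcomp Require Import boolp classical_sets cardinality.
From mathcomp Require Import mpoly.
Set Implicit Arguments.
Unset Strict Implicit.
Unset Printing Implicit Defensive.

Import GRing.Theory.
Local Open Scope ring_scope.

(** * Modules and subquotients *)

Section Modules.
Variable R : pzRingType.
Implicit Types V W : lmodType R.

(** Classical decidability turns a closed [Prop]-valued predicate into a bundled submodule;
    annihilators, cyclic submodules and kernels below are obtained this way. *)
Lemma ex_submodClosed V (P : V -> Prop) :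
  P 0 -> (forall x y, P x -> P y -> P (x + y)) ->
  (forall a x, P x -> P (a *: x)) ->
  exists N : submodClosed V, forall x, x \in N <-> P x.
Proof.
move=> P0 PD PZ; pose N : {pred V} := [pred x | `[< P x >]].
have NP x : x \in N <-> P x by split=> [/asboolP|/asboolP].
have cl : GRing.subsemimod_closed N.
  split; first split; first exact/NP.
    by move=> x y /NP Px /NP Py; apply/NP/PD.
  by move=> a x /NP Px; apply/NP/PZ.
exists (HB.pack_for (submodClosed V) N (GRing.isSubmodClosed.Build R V N cl)).
exact: NP.
Qed.

Lemma submodB V (N : submodClosed V) x y : x \in N -> y \in N -> x - y \in N.
Proof. by move=> Nx Ny; rewrite -scaleN1r rpredD // rpredZ. Qed.

Lemma isomorphic_sym V W : isomorphic V W -> isomorphic W V.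
Proof.
move=> [f [g fK gK]].
have gl : linear g by move=> a x y; rewrite -{1}[x]gK -{1}[y]gK -linearP fK.
pose gL : {linear W -> V} := HB.pack g (GRing.isLinear.Build R W V _ g gl).
by exists gL, f.
Qed.

Lemma isomorphic_trans V W X :
  isomorphic V W -> isomorphic W X -> isomorphic V X.
Proof.
move=> [f bf] [g bg]; exists (g \o f : {linear V -> X}).
by apply: bij_comp.
Qed.

(** Both modules are [R] modulo the common annihilator, and [a *: v] is sent to [a *: w]. *)
Lemma isomorphic_cyclic V W (v : V) (w : W) :
  (forall x, exists a, x = a *: v) -> (forall y, exists a, y = a *: w) ->
  (forall a, a *: v = 0 <-> a *: w = 0) -> isomorphic V W.
Proof.
move=> gv gw vw.
have e0 a b : (a *: v = b *: v) <-> (a *: w = b *: w).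
  split=> /eqP; rewrite -subr_eq0 -scalerBl => /eqP/vw/eqP;
  by rewrite scalerBl subr_eq0 => /eqP.
pose cv x := projT1 (cid (gv x)); pose cw y := projT1 (cid (gw y)).
have cvE x : x = cv x *: v by rewrite /cv; case: cid.
have cwE y : y = cw y *: w by rewrite /cw; case: cid.
pose f x := cv x *: w.
have fE a : f (a *: v) = a *: w by rewrite /f; apply/e0; rewrite -cvE.
have fl : linear f.
  move=> a x y; rewrite (cvE x) (cvE y) scalerA -scalerDl !fE.
  by rewrite scalerDl scalerA.
pose fL : {linear V -> W} := HB.pack f (GRing.isLinear.Build R V W _ f fl).
exists fL, (fun y => cw y *: v) => [x|y] /=.
  by rewrite [RHS]cvE; apply/e0; rewrite -cwE.
by rewrite fE -cwE.
Qed.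

Section Subquotient.
Variables (V : lmodType R) (N N' : submodClosed V).

Definition sqclass (y : V) (Ny : y \in N) : subquot N N' :=
  lproj (@comap_pred R V N N') (exist _ y Ny : lsub N).

Lemma sqclass_surj z : exists y (Ny : y \in N), z = sqclass Ny.
Proof. by have [[y Ny] ->] := lproj_surj z; exists y, Ny. Qed.

Lemma sqclass_eq0 y (Ny : y \in N) : sqclass Ny = 0 <-> y \in N'.
Proof. by rewrite /sqclass lproj_eq0. Qed.

Lemma sqclass_eq y y' (Ny : y \in N) (Ny' : y' \in N) :
  sqclass Ny = sqclass Ny' <-> y - y' \in N'.
Proof. by rewrite /sqclass; apply: pi_lquotE. Qed.

Lemma sqclassZ a y (Ny : y \in N) (Nay : a *: y \in N) :
  a *: sqclass Ny = sqclass Nay.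
Proof.
rewrite /sqclass -linearZ; congr (lproj _ _); exact: val_inj.
Qed.

Lemma sqclass_eqS y y' (Ny : y \in N) (Ny' : y' \in N) :
  y = y' -> sqclass Ny = sqclass Ny'.
Proof. by move=> e; apply/sqclass_eq; rewrite e subrr rpred0. Qed.

(** The multiples of the class of [y] form a nonzero submodule of a simple factor, hence exhaust
    it. *)
Lemma simple_subquot_gen y z : simple (subquot N N') ->
  y \in N -> y \notin N' -> z \in N -> exists a, z - a *: y \in N'.
Proof.
move=> [_ sN] Ny N'y Nz.
have [|||M ME] := @ex_submodClosed
  _ (fun c : subquot N N' => exists a, c = a *: sqclass Ny).
- by exists 0; rewrite scale0r.
- by move=> _ _ [a ->] [b ->]; exists (a + b); rewrite scalerDl.
- by move=> a _ [b ->]; exists (a * b); rewrite scalerA.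
have [M0|MT] := sN M.
  case/negP: N'y; apply/(sqclass_eq0 Ny)/M0/ME.
  by exists 1; rewrite scale1r.
have /ME[a] := MT (sqclass Nz); have Nay : a *: y \in N by apply: rpredZ.
by rewrite (sqclassZ _ Nay) => /sqclass_eq; exists a.
Qed.

End Subquotient.

(** For [x <> 0] the annihilator of [x] is a maximal left ideal, and the radical lies in each of
    these. *)
Lemma jacobson_simple V : simple V ->
  forall (a : R) (x : V), a \in jacobson R -> a *: x = 0.
Proof.
move=> [_ sV] a x /asboolP ja.
have [->|x0] := pselect (x = 0); first by rewrite scaler0.
have [|||m mE] := @ex_submodClosed R^o (fun b => (b : R) *: x = 0).
- by rewrite scale0r.
- by move=> b c b0 c0; rewrite scalerDl b0 c0 addr0.
- by move=> b c c0; rewrite -[b *: c]/(b * c) -scalerA c0 scaler0.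
suff mm : maximal_left_ideal m by apply/mE/ja.
split; first by exists 1; apply/negP => /mE; rewrite scale1r.
move=> N mN; have [[b Nb mb]|Nm] := pselect (exists2 b, b \in N & b \notin m).
  (* [M] is [N x]; it contains [b *: x <> 0], so it is all of [V], and each [c] agrees with an
     element of [N] modulo the annihilator of [x]. *)
  right; have [|||M ME] := @ex_submodClosed V (fun y => exists2 c : R,
    c \in N & y = c *: x).
  - by exists 0; [exact: (rpred0 N)|rewrite scale0r].
  - move=> _ _ [c Nc ->] [d Nd ->].
    by exists (c + d); [exact: (@rpredD _ N)|rewrite scalerDl].
  - move=> c _ [d Nd ->]; exists (c * d); last by rewrite scalerA.
    exact: (@rpredZ _ _ N).
  have [M0|MT] := sV M.
    by case/negP: mb; apply/mE/M0/ME; exists b.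
  move=> c; have /ME[d Nd cd] := MT ((c : R) *: x).
  rewrite -(subrK d c); apply: (@rpredD _ N) => //; apply/mN/mE.
  by rewrite scalerBl cd subrr.
by left=> b Nb; apply/negPn/negP => mb; apply: Nm; exists b.
Qed.

Lemma radpow_step V i (a : R) (x : V) :
  a \in jacobson R -> x \in radpow V i -> a *: x \in radpow V i.+1.
Proof. by move=> ja Rx; apply/asboolP => N; apply; exists a, x. Qed.

Lemma radpow_ind V i (N : submodClosed V) :
  (forall (a : R) x, a \in jacobson R -> x \in radpow V i -> a *: x \in N) ->
  {subset radpow V i.+1 <= N}.
Proof.
by move=> H x /asboolP; apply=> _ [a [y [ja Ry ->]]]; apply: H.
Qed.

Lemma radpow_decr V i : {subset radpow V i.+1 <= radpow V i}.
Proof. by apply: radpow_ind => a x _ Rx; apply: rpredZ. Qed.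

End Modules.

(** * Subpaths and powers of the arrow ideal *)

Section QuiverPaths.
Variable Q : quiver.
Implicit Types p q r : qpath Q.

Lemma qpath_eq p q : pstart p = pstart q -> parrows p = parrows q -> p = q.
Proof.
move=> e1 e2; apply: val_inj.
by rewrite [val p]surjective_pairing [val q]surjective_pairing; congr pair.
Qed.

Lemma walk_parrows p : walk (pstart p) (parrows p).
Proof. exact: (valP p). Qed.

Lemma pdrop_subproof i p : walk (pvertex p i) (drop i (parrows p)).
Proof.
have := walk_parrows p; rewrite -{1}(cat_take_drop i (parrows p)) walk_cat.
by case/andP.
Qed.
Definition pdrop i p : qpath Q := exist _ (pvertex p i, drop i (parrows p))
  (pdrop_subproof i p).

(** The subpath of [p] from position [i] to position [j]; these are the paths to which (N) is
    applied. *)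
Definition psub i j p : qpath Q := ptake (j - i) (pdrop i p).

Lemma plen_ptake i p : (i <= plen p)%N -> plen (ptake i p) = i.
Proof. by move=> ip; rewrite /plen /parrows /= size_takel. Qed.

Lemma plen_pdrop i p : plen (pdrop i p) = (plen p - i)%N.
Proof. by rewrite /plen /parrows /= size_drop. Qed.

Lemma plen_psub i j p : (i <= j <= plen p)%N -> plen (psub i j p) = (j - i)%N.
Proof.
by case/andP=> ij jp; rewrite plen_ptake // plen_pdrop leq_sub2r.
Qed.

Lemma ptake_plen p : ptake (plen p) p = p.
Proof. by apply: qpath_eq => //; rewrite /parrows /= take_size. Qed.

Lemma ptake0 p : ptake 0 p = vpath (pstart p).
Proof. by apply: qpath_eq => //; rewrite /parrows /= take0. Qed.

Lemma ptake_inj p i j : (i <= plen p)%N -> (j <= plen p)%N ->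
  ptake i p = ptake j p -> i = j.
Proof. by move=> ip jp /(congr1 (@plen Q)); rewrite !plen_ptake. Qed.

Lemma pend_ptake i p : pend (ptake i p) = pvertex p i.
Proof. by []. Qed.

Lemma pvertex0 p : pvertex p 0 = pstart p.
Proof. by rewrite /pvertex take0. Qed.

Lemma pvertex_plen p : pvertex p (plen p) = pend p.
Proof. by rewrite /pvertex take_size. Qed.

Lemma pvertex_ptake i j p : (i <= j)%N -> pvertex (ptake j p) i = pvertex p i.
Proof. by move=> ij; rewrite /pvertex /parrows /= take_takel. Qed.

Lemma pvertex_pdrop i j p : pvertex (pdrop i p) j = pvertex p (i + j).
Proof.
by rewrite /pvertex /= -wend_cat takeD.
Qed.

Lemma pvertex_psub i j k p : (k <= j - i)%N ->
  pvertex (psub i j p) k = pvertex p (i + k).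
Proof. by move=> h; rewrite /psub pvertex_ptake // pvertex_pdrop. Qed.

Lemma pstart_psub i j p : pstart (psub i j p) = pvertex p i.
Proof. by []. Qed.

Lemma pend_psub i j p : (i <= j <= plen p)%N -> pend (psub i j p) = pvertex p j.
Proof.
move=> h; rewrite -pvertex_plen plen_psub // pvertex_psub // subnKC //.
by case/andP: h.
Qed.

Lemma pvertexS i p a : (i < plen p)%N ->
  pvertex p i.+1 = tgt (nth a (parrows p) i).
Proof.
move=> ip; rewrite /pvertex (take_nth a) // /wend map_rcons last_rcons //.
Qed.

Lemma src_nth i p a : (i < plen p)%N -> src (nth a (parrows p) i) = pvertex p i.
Proof.
move=> ip; have := pdrop_subproof i p.
by rewrite (drop_nth a) //= => /andP[/eqP].
Qed.

Lemma parrows_psub i j p : parrows (psub i j p) = take (j - i) (drop i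
  (parrows p)).
Proof. by []. Qed.

Lemma psub_arrow i p a : (i < plen p)%N ->
  psub i i.+1 p = apath (nth a (parrows p) i).
Proof.
move=> ip; apply: qpath_eq; first by rewrite pstart_psub -(src_nth a ip).
by rewrite parrows_psub subSnn (drop_nth a) //= take0.
Qed.

Lemma right_subpathE u p : right_subpath u p ->
  u = ptake (plen u) p /\ (plen u <= plen p)%N.
Proof.
case/andP=> /eqP su /prefixP [t pt]; split;
  last by rewrite /plen pt size_cat leq_addr.
by apply: qpath_eq; rewrite ?su // /parrows /= -/(parrows p) pt take_size_cat.
Qed.

Lemma ptake_right_subpath i p : right_subpath (ptake i p) p.
Proof.
by rewrite /right_subpath eqxx /= /parrows /=; exact: prefix_take.
Qed.

(** The vertices fix source and target of each arrow. Injectivity is asked only for the arrows of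
    [p], which is what (N) provides on a mast. *)
Lemma pvertex_ext p q : plen p = plen q -> 
  (forall i, (i <= plen p)%N -> pvertex p i = pvertex q i) ->
  (forall a b, a \in parrows p -> src a = src b -> tgt a = tgt b -> a = b) ->
  p = q.
Proof.
move=> pq vv inj; apply: qpath_eq.
  by have := vv 0%N (leq0n _); rewrite !pvertex0.
case ep: (parrows p) => [|a0 t].
  by apply/esym/eqP; rewrite -size_eq0 -/(plen q) -pq /plen ep.
rewrite -ep; apply: (@eq_from_nth _ a0) => // i ip.
apply: inj; first exact: mem_nth.
  by rewrite !src_nth -?pq // vv // ltnW.
by rewrite -!pvertexS -?pq // vv.
Qed.

End QuiverPaths.

Section PathAlgebraPowers.
Variables (K : fieldType) (Q : quiver).
Local Notation KQ := (path_algebra K Q).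
Implicit Types (p q r : qpath Q) (f g : KQ).
Local Notation b_ := (bpath K).
Local Notation pow := (@arrow_ideal_pow K Q).

Lemma pascalerAl c f g : c *: (f * g) = (c *: f) * g.
Proof. exact/esym/pa_mulZl. Qed.

Lemma pascalerAr c f g : c *: (f * g) = f * (c *: g).
Proof. exact/esym/pa_mulZr. Qed.

Lemma bpathM_cat q p r : pstart q = pend p -> pstart r = pstart p ->
  parrows r = parrows p ++ parrows q -> b_ q * b_ p = b_ r.
Proof.
move=> e1 e2 e3; rewrite bpathM /pmul.
(* Unqualified, [pcomp] is ssrfun's composition of partial functions. *)
suff -> : Defs.pcomp q p = Some r by [].
apply/pcompP; split; first by rewrite e1.
by rewrite [val r]surjective_pairing; congr pair.
Qed.

Lemma bpathM_neq q p : pstart q <> pend p -> b_ q * b_ p = 0.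
Proof. by move=> ne; rewrite bpathM /pmul /Defs.pcomp; case: eqP => // e;
  case: ne. Qed.

Lemma bpath_pdrop i p : b_ (pdrop i p) * b_ (ptake i p) = b_ p.
Proof. by apply: bpathM_cat => //; rewrite /parrows /= cat_take_drop. Qed.

Lemma bpath_psub i j p : (i <= j)%N ->
  b_ (psub i j p) * b_ (ptake i p) = b_ (ptake j p).
Proof.
move=> ij; apply: bpathM_cat => //.
by rewrite /parrows /= -takeD subnKC.
Qed.

Lemma bpath_step i p a : (i < plen p)%N ->
  b_ (apath (nth a (parrows p) i)) * b_ (ptake i p) = b_ (ptake i.+1 p).
Proof. by move=> ip; rewrite -(bpath_psub _ (leqnSn i)) (psub_arrow a). Qed.

Lemma bpath_pend p : b_ (vpath (pend p)) * b_ p = b_ p.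
Proof. by apply: bpathM_cat => //; rewrite cats0. Qed.

Lemma bpath_pstart p : b_ p * b_ (vpath (pstart p)) = b_ p.
Proof. by apply: bpathM_cat. Qed.

Lemma vpathM e e' : b_ (vpath e) * b_ (vpath e') = (e == e')%:R *:
  b_ (vpath e) :> KQ.
Proof.
case: eqP => [->|ne]; last by rewrite scale0r bpathM_neq.
by rewrite scale1r -[RHS]bpath_pend.
Qed.

Lemma arrow_pow0 n : pow n 0.
Proof. by move=> p; rewrite pcoef0. Qed.

Lemma arrow_powD n f g : pow n f -> pow n g -> pow n (f + g).
Proof.
move=> hf hg p; rewrite pcoefD => ne.
have [f0|f0] := pselect (pcoef p f = 0); last exact: hf.
by apply: hg => g0; apply: ne; rewrite f0 g0 addr0.
Qed.

Lemma arrow_powZ n c f : pow n f -> pow n (c *: f).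
Proof.
by move=> hf p; rewrite pcoefZ => ne; apply: hf => f0; apply: ne;
  rewrite f0 mulr0.
Qed.

Lemma arrow_powU n p : (n <= plen p)%N -> pow n (b_ p).
Proof. by move=> np q; rewrite pcoefU; case: eqP => [<-|]. Qed.

Lemma arrow_pow_le m n f : (m <= n)%N -> pow n f -> pow m f.
Proof. by move=> mn hf p /hf; apply: leq_trans. Qed.

Lemma arrow_pow_all f : pow 0 f. Proof. by []. Qed.

Lemma arrow_pow_sum n (J : Type) (s : seq J) (P : pred J) (F : J -> KQ) :
  (forall j, P j -> pow n (F j)) -> pow n (\sum_(j <- s | P j) F j).
Proof.
by move=> h; apply: big_ind => //; [apply: arrow_pow0|apply: arrow_powD].
Qed.

Lemma arrow_pow_ind n (P : KQ -> Prop) :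
  P 0 -> (forall f g, P f -> P g -> P (f + g)) ->
  (forall c f, P f -> P (c *: f)) ->
  (forall p, (n <= plen p)%N -> P (b_ p)) ->
  forall f, pow n f -> P f.
Proof.
move=> P0 PD PZ PU f hf; rewrite (path_algebraE f).
apply: big_ind => // p _.
have [f0|f0] := pselect (pcoef p f = 0); first by rewrite f0 scale0r.
by apply/PZ/PU/hf.
Qed.

Lemma arrow_powM m n f g : pow m f -> pow n g -> pow (m + n) (f * g).
Proof.
move=> hf hg; elim/(@arrow_pow_ind n): g / hg => [|g g' hg hg'|c g hg|p np].
- by rewrite mulr0; apply: arrow_pow0.
- by rewrite mulrDr; apply: arrow_powD.
- by rewrite -pascalerAr; apply: arrow_powZ.
elim/(@arrow_pow_ind m): f / hf => [|f f' hf hf'|c f hf|q mq].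
- by rewrite mul0r; apply: arrow_pow0.
- by rewrite mulrDl; apply: arrow_powD.
- by rewrite -pascalerAl; apply: arrow_powZ.
rewrite bpathM /pmul; case E: Defs.pcomp => [r|]; last exact: arrow_pow0.
move/pcompP: E => [_ rE]; apply: arrow_powU.
by rewrite /plen /parrows rE size_cat addnC leq_add.
Qed.

Lemma arrow_powX n f : pow 1 f -> pow n (f ^+ n).
Proof.
move=> hf; elim: n => [|n IH]; first exact: arrow_pow_all.
by rewrite exprS -(add1n n); apply: arrow_powM.
Qed.

(** A product of paths has length 0 only if both factors do, so the coefficient at [e] is a
    character of the path algebra. *)
Lemma pcoef_vpathM e f g :
  pcoef (vpath e) (f * g) = pcoef (vpath e) f * pcoef (vpath e) g.
Proof.
elim/pa_ind: f => [|f f' hf hf'|c f hf|q].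
- by rewrite mul0r pcoef0 mul0r.
- by rewrite mulrDl !pcoefD mulrDl hf hf'.
- by rewrite -pascalerAl !pcoefZ hf mulrA.
elim/pa_ind: g => [|g g' hg hg'|c g hg|p].
- by rewrite mulr0 pcoef0 mulr0.
- by rewrite mulrDr !pcoefD mulrDr hg hg'.
- by rewrite -pascalerAr !pcoefZ hg mulrCA.
rewrite bpathM /pmul; case E: Defs.pcomp =>
  [r|]. move/pcompP: E => [pq rE].
  rewrite !pcoefU -natrM mulnb; congr (_%:R); congr nat_of_bool.
  apply/eqP/andP => [re|[/eqP qe /eqP pe]].
    have {re} : val r = val (vpath e) by rewrite re.
    rewrite rE => -[se]; case ep: (parrows p) => [|//] /= eq.
    split; apply/eqP/qpath_eq; rewrite //.
    by rewrite -pq /pend ep /= se.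
  by apply: val_inj; rewrite rE pe qe.
rewrite pcoef0 !pcoefU; case: (q =P _) => [qe|_]; last by rewrite mul0r.
case: (p =P _) => [pe|_]; last by rewrite mulr0.
by move/pcompN: E; rewrite qe pe.
Qed.

(** The component of [f] in the ideal generated by the arrows. *)
Definition radpart f : KQ := f - \sum_e pcoef (vpath e) f *: b_ (vpath e).

Lemma radpart_pow f : pow 1 (radpart f).
Proof.
move=> p; rewrite lt0n /plen => ne; apply/negP => /nilP p0; apply: ne.
have -> : p = vpath (pstart p) by apply: qpath_eq.
rewrite /radpart -scaleN1r pcoefD pcoefZ pcoef_sum (bigD1 (pstart p)) //= big1.
  by rewrite addr0 pcoefZ pcoefU eqxx mulr1 mulN1r subrr.
move=> e ne; rewrite pcoefZ pcoefU; case: eqP; rewrite ?mulr0 //.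
by move=> /(congr1 (@pstart Q)) /eqP; rewrite (negPf ne).
Qed.

Lemma radpartE f e : f * b_ (vpath e) =
  pcoef (vpath e) f *: b_ (vpath e) + radpart f * b_ (vpath e).
Proof.
rewrite {1}(_ : f = \sum_e pcoef (vpath e) f *: b_ (vpath e) + radpart f).
  rewrite mulrDl; congr (_ + _); rewrite mulr_suml (bigD1 e) //= big1 ?addr0.
    by rewrite -pascalerAl vpathM eqxx scale1r.
  by move=> e' ne; rewrite -pascalerAl vpathM (negPf ne) scale0r scaler0.
by rewrite addrC subrK.
Qed.

(** Every path occurring in [w * b_ (apath a)] starts with [a], whereas [p] has coefficient 1 on the
    left. This and its dual [bpath_ends] translate (N) into arrow lists. *)
Lemma bpath_starts p a (w : KQ) : b_ p = w * b_ (apath a) ->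
  ohead (parrows p) = Some a.
Proof.
move=> e; apply/eqP/negPn/negP => ne.
have : pcoef p (w * b_ (apath a)) = 0; last first.
  by rewrite -e pcoefU eqxx => /eqP; rewrite oner_eq0.
elim/pa_ind: {e} w => [|f f' hf hf'|c f hf|q].
- by rewrite mul0r pcoef0.
- by rewrite mulrDl pcoefD hf hf' addr0.
- by rewrite -pascalerAl pcoefZ hf mulr0.
rewrite bpathM /pmul; case E: Defs.pcomp => [r|]; last by rewrite pcoef0.
move/pcompP: E => [_ rE]; rewrite pcoefU; case: eqP => // rp.
by move: ne; rewrite /parrows -rp rE /= eqxx.
Qed.

Lemma bpath_ends p a (w : KQ) : b_ p = b_ (apath a) * w ->
  exists t, parrows p = rcons t a.
Proof.
move=> e; have [//|ne] := pselect (exists t, parrows p = rcons t a).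
have : pcoef p (b_ (apath a) * w) = 0; last first.
  by rewrite -e pcoefU eqxx => /eqP; rewrite oner_eq0.
elim/pa_ind: {e} w => [|f f' hf hf'|c f hf|q].
- by rewrite mulr0 pcoef0.
- by rewrite mulrDr pcoefD hf hf' addr0.
- by rewrite -pascalerAr pcoefZ hf mulr0.
rewrite bpathM /pmul; case E: Defs.pcomp => [r|]; last by rewrite pcoef0.
move/pcompP: E => [_ rE]; rewrite pcoefU; case: eqP => // rp.
by case: ne; exists (parrows q); rewrite /parrows -rp rE cats1.
Qed.

End PathAlgebraPowers.

(** * The radical of Lambda and its vertex simples *)

Section Action.
Variables (K : fieldType) (Q : quiver) (I : ideal (path_algebra K Q)).
Local Notation KQ := (path_algebra K Q).
Local Notation L := (Lambda I).
Local Notation b_ := (bpath K).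
Local Notation "c %:S" := (c *: (1 : KQ)) (at level 2, format "c %:S").
Local Notation pow := (@arrow_ideal_pow K Q).
Implicit Types (f g : KQ) (U V W : lmodType L).

Lemma to_LambdaD f g : to_Lambda I (f + g) = to_Lambda I f + to_Lambda I g.
Proof. exact: (rmorphD (rproj I)). Qed.
Lemma to_LambdaM f g : to_Lambda I (f * g) = to_Lambda I f * to_Lambda I g.
Proof. exact: (rmorphM (rproj I)). Qed.
Lemma to_Lambda1 : to_Lambda I 1 = 1.
Proof. exact: (rmorph1 (rproj I)). Qed.
Lemma to_Lambda0 : to_Lambda I 0 = 0.
Proof. exact: (rmorph0 (rproj I)). Qed.
Lemma to_LambdaB f g : to_Lambda I (f - g) = to_Lambda I f - to_Lambda I g.
Proof. exact: (rmorphB (rproj I)). Qed.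
Lemma to_LambdaX f n : to_Lambda I (f ^+ n) = to_Lambda I f ^+ n.
Proof. exact: (rmorphXn (rproj I)). Qed.
Lemma to_Lambda_eq0 f : to_Lambda I f = 0 <-> f \in I.
Proof. exact: rproj_eq0. Qed.
Lemma to_Lambda_surj (a : L) : exists f, a = to_Lambda I f.
Proof. exact: rproj_surj. Qed.

(** Modules over [Lambda] are treated as modules over the path algebra, on which [I] acts as zero;
    the field acts through [c%:S]. *)
Definition act U f (x : U) : U := to_Lambda I f *: x.

Lemma actDl U f g (x : U) : act (f + g) x = act f x + act g x.
Proof. by rewrite /act to_LambdaD scalerDl. Qed.
Lemma actDr U f (x y : U) : act f (x + y) = act f x + act f y.
Proof. exact: scalerDr. Qed.
Lemma actM U f g (x : U) : act (f * g) x = act f (act g x).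
Proof. by rewrite /act to_LambdaM scalerA. Qed.
Lemma act1 U (x : U) : act 1 x = x.
Proof. by rewrite /act to_Lambda1 scale1r. Qed.
Lemma act0l U (x : U) : act 0 x = 0.
Proof. by rewrite /act to_Lambda0 scale0r. Qed.
Lemma act0r U f : act f (0 : U) = 0.
Proof. exact: scaler0. Qed.
Lemma actBl U f g (x : U) : act (f - g) x = act f x - act g x.
Proof. by rewrite /act to_LambdaB scalerBl. Qed.
Lemma actBr U f (x y : U) : act f (x - y) = act f x - act f y.
Proof. exact: scalerBr. Qed.
Lemma actZl U c f (x : U) : act (c *: f) x = act c%:S (act f x).
Proof. by rewrite -actM -pascalerAl mul1r. Qed.
Lemma actZr U c f (x : U) : act f (act c%:S x) = act (c *: f) x.
Proof. by rewrite -actM -pascalerAr mulr1. Qed.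
Lemma act_suml U (J : Type) (s : seq J) (P : pred J) (F : J -> KQ) (x : U) :
  act (\sum_(j <- s | P j) F j) x = \sum_(j <- s | P j) act (F j) x.
Proof. exact: (big_morph (fun f => act f x) (fun f g =>
  actDl f g x) (act0l x)). Qed.
Lemma act_in U f (x : U) (N : submodClosed U) : x \in N -> act f x \in N.
Proof. exact: rpredZ. Qed.
Lemma act_lin U V (h : {linear U -> V}) f x : h (act f x) = act f (h x).
Proof. exact: linearZ. Qed.
Lemma act_scal_eq0 U c (x : U) : act c%:S x = 0 -> x <> 0 -> c = 0.
Proof.
move=> h x0; have [//|c0] := eqVneq c 0; case: x0.
by rewrite -[x]act1 -(scale1r (1 : KQ)) -(mulVf c0) -scalerA actZl h act0r.
Qed.

Lemma ex_submod_act U (P : U -> Prop) :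
  P 0 -> (forall x y, P x -> P y -> P (x + y)) ->
  (forall f x, P x -> P (act f x)) ->
  exists N : submodClosed U, forall x, x \in N <-> P x.
Proof.
move=> P0 PD PZ; apply: ex_submodClosed => // a x Px.
by have [f ->] := to_Lambda_surj a; apply: PZ.
Qed.

Lemma isomorphic_act V W (v : V) (w : W) :
  (forall x, exists f, x = act f v) -> (forall y, exists f, y = act f w) ->
  (forall f, act f v = 0 <-> act f w = 0) -> isomorphic V W.
Proof.
move=> gv gw vw; apply: (@isomorphic_cyclic _ V W v w).
- by move=> x; have [f ->] := gv x; exists (to_Lambda I f).
- by move=> x; have [f ->] := gw x; exists (to_Lambda I f).
- by move=> a; have [f ->] := to_Lambda_surj a; apply: vw.
Qed.

Lemma act_const U e (v : U) f : act (b_ (vpath e)) v = v ->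
  act f v = act (pcoef (vpath e) f)%:S v + act (radpart f) v.
Proof.
move=> ev; rewrite -{1}ev -actM radpartE actDl actM ev; congr (_ + _).
by rewrite -[b_ _]mul1r pascalerAl actM ev.
Qed.

Section Radical.
Hypothesis adm : admissible I.

Lemma adm_pow2 f : f \in I -> pow 2 f.
Proof. exact: adm.1. Qed.

(** For each vertex [e] the kernel of the coefficient at [e] is a maximal left ideal, so elements of
    the radical have no terms of length 0. Conversely the arrow ideal is nilpotent modulo [I], hence
    lies in every maximal left ideal. *)
Lemma in_jacobson f : to_Lambda I f \in jacobson L <-> pow 1 f.
Proof.
split=> [/asboolP jf p|hf].
  rewrite lt0n => ne; apply/negP => /nilP p0; apply: ne.
  have -> : p = vpath (pstart p) by apply: qpath_eq.
  move: (pstart p) => e {p p0}.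
  (* The coefficient at [e] does not depend on the representative, as elements of [I] have no terms
     of length below 2. *)
  have pf (x : L^o) g g' : x = to_Lambda I g -> x = to_Lambda I g' ->
      pcoef (vpath e) g = pcoef (vpath e) g'.
    move=> -> /eqP; rewrite -subr_eq0 -to_LambdaB =>
      /eqP /to_Lambda_eq0 /adm_pow2 h.
    have h0 : pcoef (vpath e) (g - g') = 0 by apply: contrapT => /h.
    by apply/eqP; rewrite -subr_eq0 -h0 -scaleN1r pcoefD pcoefZ mulN1r.
  have [|||m mE] := @ex_submodClosed _ L^o
    (fun x => exists2 g, x = to_Lambda I g & pcoef (vpath e) g = 0).
  - by exists 0; rewrite ?to_Lambda0 ?pcoef0.
  - move=> _ _ [g -> g0] [h -> h0]; exists (g + h); first by rewrite to_LambdaD.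
    by rewrite pcoefD g0 h0 addr0.
  - move=> a _ [g -> g0]; have [h ->] := to_Lambda_surj a.
    exists (h * g); first by rewrite to_LambdaM.
    by rewrite pcoef_vpathM g0 mulr0.
  have mm : maximal_left_ideal m.
    split.
      exists (to_Lambda I (b_ (vpath e))); apply/negP => /mE[g eg g0].
      have := pf _ _ _ erefl eg; rewrite g0 pcoefU eqxx => /eqP.
      by rewrite oner_eq0.
    move=> N mN; have [[x Nx mx]|Nm] := pselect (exists2 x,
      x \in N & x \notin m).
      right=> y; have [h xh] := to_Lambda_surj x; have [k ->] :=
        to_Lambda_surj y.
      have h0 : pcoef (vpath e) h != 0.
        by apply: contra mx => /eqP h0; apply/mE; exists h.
      (* The scalar making the coefficient of [k - c *: h] at [e] vanish. *)
      pose c := pcoef (vpath e) k / pcoef (vpath e) h.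
      rewrite -(subrK (c *: h) k) to_LambdaD; apply: (@rpredD _ N).
        apply/mN/mE; exists (k - c *: h) => //.
        by rewrite -scaleN1r pcoefD !pcoefZ divfK // mulN1r subrr.
      rewrite -[h]mul1r pascalerAl to_LambdaM; apply: (@rpredZ _ _ N).
      by rewrite -xh.
    by left=> x Nx; apply/negPn/negP => mx; apply: Nm; exists x.
  have /mE[g fg g0] := jf m mm.
  by rewrite (pf _ f g erefl fg) g0.
apply/asboolP => m [[x mx] maxm]; apply/negPn/negP => mf.
have [|||N NE] := @ex_submodClosed _ L^o
  (fun y => exists2 z, z \in m & exists b : L, y = z + b * to_Lambda I f).
- by exists 0; [exact: (rpred0 m)|exists 0; rewrite mul0r addr0].
- move=> _ _ [z mz [b ->]] [z' mz' [b' ->]].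
  exists (z + z'); [exact: (@rpredD _ m)|exists (b + b')].
  by rewrite mulrDl addrACA.
- move=> a _ [z mz [b ->]]; exists (a *: z); first exact: (@rpredZ _ _ m).
  by exists (a * b); rewrite -[a *: _]/(a * _) mulrDr mulrA.
have [|Nm|NT] := maxm N.
- by move=> z mz; apply/NE; exists z => //; exists 0; rewrite mul0r addr0.
- case/negP: mf; apply/Nm/NE; exists 0; first exact: (rpred0 m).
  by exists 1; rewrite mul1r add0r.
have /NE[z mz [b]] := NT 1; have [h ->] := to_Lambda_surj b.
rewrite -to_LambdaM => e1; have {e1}zE : 1 - to_Lambda I (h * f) = z.
  by rewrite e1 addrK.
have [_ [k _ kI]] := adm; pose g := h * f.
have gn : to_Lambda I g ^+ k = 0.
  rewrite -to_LambdaX; apply/to_Lambda_eq0/kI/arrow_powX.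
  by rewrite -(add0n 1%N); apply: arrow_powM.
suff m1 : 1 \in m.
  by case/negP: mx; rewrite -[x]mulr1; apply: (@rpredZ _ _ m).
(* Geometric series: [h * f] is nilpotent modulo [I], so [z = 1 - h * f] has a left inverse and [m]
   would contain 1. *)
have -> : 1 = (\sum_(i < k) to_Lambda I g ^+ i) * z :> L.
  rewrite -zE -/g; have := subrX1 (to_Lambda I g) k.
  rewrite gn sub0r => /eqP; rewrite eqr_oppLR => /eqP {1}->.
  rewrite -mulNr opprB; apply: commr_sum => i _.
  by apply/commrX/commr_sym/commrB; [apply/commr1|apply/commr_refl].
exact: (@rpredZ _ _ m).
Qed.

Lemma jac_ex (a : L) : a \in jacobson L -> exists2 f,
  a = to_Lambda I f & pow 1 f.
Proof. by have [f ->] := to_Lambda_surj a => /in_jacobson; exists f. Qed.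

Lemma simple_pow V : simple V -> forall f (x : V), pow 1 f -> act f x = 0.
Proof. by move=> sV f x /in_jacobson; apply: jacobson_simple. Qed.

Lemma radpow_act_step U i f (x : U) :
  pow 1 f -> x \in radpow U i -> act f x \in radpow U i.+1.
Proof. by move/in_jacobson => hf; apply: radpow_step. Qed.

Lemma radpow_act_ind U i (N : submodClosed U) :
  (forall f x, pow 1 f -> x \in radpow U i -> act f x \in N) ->
  {subset radpow U i.+1 <= N}.
Proof.
by move=> H; apply: radpow_ind => a x /jac_ex[f -> hf]; apply: H.
Qed.

(** Of a path of length at least [n], the first [n] arrows descend one step each and the rest
    preserves the submodule. The filtration is arbitrary because both [radpow] and composition
    chains are needed. *)
Lemma filtration_act U (N : nat -> submodClosed U) (m : nat) :
  (forall i f x, (i < m)%N -> pow 1 f -> x \in N i -> act f x \in N i.+1) ->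
  forall i n f x, (i + n <= m)%N -> pow n f -> x \in N i ->
    act f x \in N (i + n)%N.
Proof.
move=> step i n f x im hf Nx; elim/(@arrow_pow_ind K Q n): f / hf =>
  [|f g hf hg|c f hf|p np].
- by rewrite act0l rpred0.
- by rewrite actDl rpredD.
- by rewrite actZl act_in.
rewrite -(bpath_pdrop K n p) actM; apply: act_in.
suff H j : (j <= n)%N -> act (b_ (ptake j p)) x \in N (i + j)%N by apply: H.
elim: j => [_|j IH jn]; first by rewrite addn0 act_in.
case ep: (parrows p) => [|a t].
  by move: (leq_trans jn np); rewrite /plen ep.
rewrite -(bpath_step K a (leq_trans jn np)) actM addnS.
apply: step; [|exact: arrow_powU|exact/IH/ltnW].
by rewrite (leq_trans _ im) // ltn_add2l.
Qed.

Lemma radpow_filtration U i n f (x : U) :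
  pow n f -> x \in radpow U i -> act f x \in radpow U (i + n).
Proof.
apply: (@filtration_act _ _ (i + n)) => // j g y _.
exact: radpow_act_step.
Qed.

(** An intrinsic description of the simple module at [e], used to compare [Svertex], the radical
    layers and the modules [S i]. *)
Definition vsimple e V := exists v : V, [/\ v <> 0, act (b_ (vpath e)) v = v,
  forall f, pow 1 f -> act f v = 0 & forall y, exists c : K, y = act c%:S v].

Lemma vsimple_act e V (v : V) f : act (b_ (vpath e)) v = v ->
  (forall g, pow 1 g -> act g v = 0) -> act f v = act (pcoef (vpath e) f)%:S v.
Proof.
move=> ev rv; rewrite (act_const _ ev) (rv (radpart f)) ?addr0 //;
  exact: radpart_pow.
Qed.

Lemma vsimple_simple e V : vsimple e V -> simple V.
Proof.
move=> [v [v0 ev rv gv]]; split; first by exists v.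
move=> N; have [[x Nx x0]|N0] := pselect (exists2 x, x \in N & x <> 0).
  right=> y; have [c xc] := gv x; have c0 : c != 0.
    by apply/eqP => c0; apply: x0; rewrite xc c0 scale0r act0l.
  have [d ->] := gv y; rewrite -(divfK c0 d) -scalerA actZl -xc.
  exact: act_in.
by left=> x Nx; apply: contrapT => x0; apply: N0; exists x.
Qed.

Lemma vsimple_iso e V W : vsimple e V -> vsimple e W -> isomorphic V W.
Proof.
move=> [v [v0 ev rv gv]] [w [w0 ew rw gw]].
apply: (@isomorphic_act _ _ v w).
- by move=> x; have [c ->] := gv x; exists c%:S.
- by move=> x; have [c ->] := gw x; exists c%:S.
move=> f; rewrite (vsimple_act _ ev rv) (vsimple_act _ ew rw).
by split=> h; [rewrite (act_scal_eq0 h v0)|rewrite (act_scal_eq0 h w0)];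
  rewrite scale0r act0l.
Qed.

Lemma vsimple_uniq e e' V : vsimple e V -> vsimple e' V -> e = e'.
Proof.
move=> [v [v0 ev rv gv]] [w [w0 ew _ _]]; apply: contrapT => /eqP ne.
apply: w0; have [c wc] := gv w.
rewrite -ew wc actZr -ev -actM -pascalerAl vpathM eq_sym (negPf ne).
by rewrite scale0r scaler0 act0l.
Qed.

Lemma vsimple_transfer e V W : isomorphic V W -> vsimple e V -> vsimple e W.
Proof.
move=> [h [k hK kK]] [v [v0 ev rv gv]]; exists (h v); split.
- by move=> hv; apply: v0; rewrite -(hK v) hv -(linear0 h) hK.
- by rewrite -act_lin ev.
- by move=> f hf; rewrite -act_lin rv // linear0.
- by move=> y; have [c yc] := gv (k y); exists c; rewrite -act_lin -yc kK.
Qed.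

Lemma vsimple_subquot e V (N N' : submodClosed V) v :
  act (b_ (vpath e)) v = v ->
  v \in N -> v \notin N' -> (forall f, pow 1 f -> act f v \in N') ->
  (forall y, y \in N -> exists c : K, y - act c%:S v \in N') ->
  vsimple e (subquot N N').
Proof.
move=> ev Nv N'v rv gv; exists (sqclass N' Nv); split.
- by move=> /sqclass_eq0 h; rewrite h in N'v.
- by rewrite /act (@sqclassZ _ _ _ _ _ _ Nv (act_in _ Nv)); apply: sqclass_eqS.
- move=> f hf; rewrite /act (@sqclassZ _ _ _ _ _ _ Nv (act_in _ Nv));
  apply/sqclass_eq0.
  exact: rv.
move=> z; have [y [Ny ->]] := sqclass_surj z; have [c yc] := gv y Ny.
exists c; rewrite /act (@sqclassZ _ _ _ _ _ _ Nv (act_in _ Nv));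
  exact/sqclass_eq.
Qed.

Lemma vsimple_Svertex e : vsimple e (Svertex I e).
Proof.
set t := to_Lambda I (b_ (vpath e)).
apply: (@vsimple_subquot e L^o (rmul (full L^o) t) (rmul (jacobson L) t) t).
- by rewrite /act -[_ *: _]/(_ * _) -to_LambdaM vpathM eqxx scale1r.
- by apply/asboolP; exists 1; rewrite ?mul1r.
(* [e] is not in [J e]: otherwise [e - f e], with coefficient 1 at the trivial path, would lie in
   [I]. *)
- apply/negP => /asboolP[a /jac_ex[f -> hf]].
  rewrite -to_LambdaM => /eqP; rewrite -subr_eq0 -to_LambdaB.
  move=> /eqP/to_Lambda_eq0/adm_pow2 /(_ (vpath e)).
  rewrite -scaleN1r pcoefD pcoefZ pcoef_vpathM pcoefU eqxx.
  have [->|h] := eqVneq (pcoef (vpath e) f) 0.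
    by rewrite mul0r mulr0 addr0 => /(_ (fun h =>
      negP (oner_neq0 K) (introT eqP h))).
  by have := hf (vpath e) (fun h0 => negP h (introT eqP h0)).
- move=> f hf; apply/asboolP; exists (to_Lambda I f) => //.
  exact/in_jacobson.
move=> y /asboolP[a _ ->]; have [f ->] := to_Lambda_surj a.
exists (pcoef (vpath e) f); apply/asboolP; exists (to_Lambda I (radpart f)).
  exact/in_jacobson/radpart_pow.
rewrite /act -[_ *: _]/(_ * _) -!to_LambdaM -to_LambdaB; congr (to_Lambda I _).
by rewrite radpartE -pascalerAl mul1r addrC addKr.
Qed.

End Radical.
End Action.

(** * Uniserial modules with a given mast *)

Section Frames.
Variables (K : fieldType) (Q : quiver) (I : ideal (path_algebra K Q)).
Hypothesis adm : admissible I.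
Local Notation KQ := (path_algebra K Q).
Local Notation L := (Lambda I).
Local Notation b_ := (bpath K).
Local Notation "c %:S" := (c *: (1 : KQ)) (at level 2, format "c %:S").
Local Notation pow := (@arrow_ideal_pow K Q).
Implicit Types (f g : KQ) (U V W : lmodType L) (p : qpath Q) (c d : nat -> K).

(** Coefficients are functions on [nat], so that they can be shifted freely; only the values up to
    [plen p] count. *)
Definition prefix_comb p c : KQ :=
  \sum_(0 <= i < (plen p).+1) c i *: b_ (ptake i p).

Lemma prefix_combD p c d :
  prefix_comb p (fun i => c i + d i) = prefix_comb p c + prefix_comb p d.
Proof. by rewrite /prefix_comb -big_split; apply: eq_bigr => i _;
  rewrite scalerDl. Qed.

Lemma prefix_combZ p a c : prefix_comb p (fun i => a * c i) = a *:
  prefix_comb p c.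
Proof. by rewrite /prefix_comb scaler_sumr; apply: eq_bigr => i _;
  rewrite scalerA. Qed.

Lemma prefix_comb0 p : prefix_comb p (fun=> 0) = 0.
Proof. by rewrite /prefix_comb big1 // => i _; rewrite scale0r. Qed.

Lemma prefix_combB p c d :
  prefix_comb p (fun i => c i - d i) = prefix_comb p c - prefix_comb p d.
Proof.
rewrite -scaleN1r -prefix_combZ -prefix_combD.
by apply: eq_bigr => i _; rewrite mulN1r.
Qed.

Lemma eq_prefix_comb p c d : (forall i, (i <= plen p)%N -> c i = d i) ->
  prefix_comb p c = prefix_comb p d.
Proof.
move=> cd; rewrite /prefix_comb !big_mkord; apply: eq_bigr => i _.
by rewrite cd // -ltnS.
Qed.

Lemma prefix_comb_delta p i : (i <= plen p)%N ->
  prefix_comb p (fun j => (j == i)%:R) = b_ (ptake i p).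
Proof.
move=> ip; rewrite /prefix_comb big_mkord (bigD1 (Ordinal (ip :
  i < (plen p).+1)%N)) //=.
rewrite eqxx scale1r big1 ?addr0 // => j ne; case: eqP =>
  [ji|_]; rewrite ?scale0r //.
by case/eqP: ne; apply: val_inj.
Qed.

Lemma prefix_comb_pow p c i : (forall j, (j < i)%N -> c j = 0) ->
  pow i (prefix_comb p c).
Proof.
move=> c0; rewrite /prefix_comb big_mkord; apply: arrow_pow_sum => j _.
have [ij|ji] := leqP i j; last by rewrite c0 // scale0r; apply: arrow_pow0.
by apply/arrow_powZ/arrow_powU; rewrite plen_ptake // -ltnS.
Qed.

Lemma prefix_comb_lead p c i : (i <= plen p)%N -> (forall j, (j < i)%N ->
  c j = 0) ->
  exists2 g, pow i.+1 g & prefix_comb p c = c i *: b_ (ptake i p) + g.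
Proof.
move=> ip c0; exists (prefix_comb p (fun j => c j - c i * (j == i)%:R)).
  apply: prefix_comb_pow => j; rewrite ltnS leq_eqVlt =>
    /orP[/eqP->|ji]. by rewrite eqxx mulr1 subrr.
  by rewrite c0 // (ltn_eqF ji) mulr0 subrr.
by rewrite prefix_combB prefix_combZ prefix_comb_delta // addrC subrK.
Qed.

Lemma vpath_prefix_comb p c e :
  b_ (vpath e) * prefix_comb p c = prefix_comb p (fun i =>
    (pvertex p i == e)%:R * c i).
Proof.
rewrite /prefix_comb mulr_sumr; apply: eq_bigr => i _.
rewrite -pascalerAr -[b_ (ptake i p)]bpath_pend mulrA vpathM pend_ptake eq_sym.
case: eqP => [->|]; last by rewrite scale0r mul0r scaler0 mul0r scale0r.
by rewrite mul1r scale1r.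
Qed.

(* [x] generates [U], and the prefixes of [p] applied to [x] form a basis of
   [U] over [K]. *)
Definition frame p U (x : U) : Prop :=
  [/\ act (b_ (vpath (pstart p))) x = x, act (b_ p) x <> 0,
      forall y, exists c, y = act (prefix_comb p c) x &
      forall f, pow (plen p).+1 f -> forall y : U, act f y = 0].

Section FrameTheory.
Variables (p : qpath Q) (U : lmodType L) (x : U).
Hypothesis fx : frame p x.
Let l := plen p.

(** Multiplication by the part of [p] after position [j] turns the right side into [c j] times
    [p x], the earlier coefficients being 0 by induction, and kills the left side by length. *)
Lemma frame_low i f c : pow i f -> act f x = act (prefix_comb p c) x ->
  forall j, (j < i)%N -> (j <= l)%N -> c j = 0.
Proof.
case: fx => _ px _ kill hf fc j; elim/ltn_ind: j => j IH ji jl.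
have [|g hg cE] := @prefix_comb_lead p c j jl.
  by move=> k kj; apply: (IH k kj); [apply: ltn_trans
    ji|apply: leq_trans (ltnW kj) jl].
have lE : (l - j + j.+1 = (plen p).+1)%N by rewrite addnS subnK.
apply: (act_scal_eq0 _ px).
have -> : act (c j)%:S (act (b_ p) x) =
    act (b_ (pdrop j p)) (act (prefix_comb p c) x).
  rewrite cE -[RHS]actM mulrDr actDl -pascalerAr bpath_pdrop -actZl.
  rewrite [X in _ + X]kill ?addr0 // -lE.
  by apply: arrow_powM => //; apply: arrow_powU; rewrite plen_pdrop.
rewrite -fc -actM; apply: kill; rewrite -lE.
by apply: arrow_powM (arrow_pow_le ji hf); apply: arrow_powU;
  rewrite plen_pdrop.
Qed.

Lemma frame_uniq c d : act (prefix_comb p c) x = act (prefix_comb p d) x ->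
  forall j, (j <= l)%N -> c j = d j.
Proof.
move=> cd j jl; apply/eqP; rewrite -subr_eq0; apply/eqP.
apply: (@frame_low l.+1 0 (fun j => c j - d j)) => //; first exact: arrow_pow0.
by rewrite prefix_combB actBl cd subrr act0l.
Qed.

Lemma frame_pow i f : pow i f ->
  exists2 c, act f x = act (prefix_comb p c) x & forall j, (j < i)%N -> c j = 0.
Proof.
move=> hf; case: (fx) => _ _ gen _; have [c fc] := gen (act f x).
(* The coefficients beyond [l] do not matter and are reset to 0, since [frame_low] only reaches
   [j <= l]. *)
exists (fun j => if (j <= l)%N then c j else 0).
  by rewrite fc; congr act; apply: eq_prefix_comb => j ->.
by move=> j ji; case: ifP => // jl; apply: (frame_low hf fc).
Qed.

Lemma frame_target e c : act (b_ (vpath e)) (act (prefix_comb p c) x) = act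
  (prefix_comb p c) x ->
  forall j, (j <= l)%N -> pvertex p j <> e -> c j = 0.
Proof.
rewrite -actM vpath_prefix_comb => h j jl /eqP ne.
by rewrite -(frame_uniq h) // (negPf ne) mul0r.
Qed.

(** Degree and end vertex restrict the expansion. Applied to an arrow after a right subpath, it
    leaves only the longer right subpaths that end where the arrow does. *)
Lemma frame_expand e i f : b_ (vpath e) * f = f -> pow i f ->
  exists c, act f x = act (prefix_comb p c) x /\
    forall j, (j < i)%N || (pvertex p j != e) -> (j <= l)%N -> c j = 0.
Proof.
move=> ef hf; have [c fc c0] := frame_pow hf; exists c;
  split=> // j /orP[/c0 //|/eqP ne jl].
by apply: (@frame_target e) => //; rewrite -fc -actM ef.
Qed.

Lemma frame_radpow i y : y \in radpow U i <-> exists2 f, pow i f & y = act f x.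
Proof.
case: (fx) => ex _ gen _; split=> [|[f hf ->]]; last first.
  by rewrite -(add0n i); apply: radpow_filtration.
elim: i y => [|i IH] y.
  by move=> _; have [c ->] := gen y; exists (prefix_comb p c).
have [|||N NE] := @ex_submod_act _ _ _ U (fun y => exists2 f,
  pow i.+1 f & y = act f x).
- by exists 0; [apply: arrow_pow0|rewrite act0l].
- by move=> _ _ [f hf ->] [g hg ->]; exists (f + g);
  [apply: arrow_powD|rewrite actDl].
- move=> g _ [f hf ->]; exists (g * f); last by rewrite actM.
  by rewrite -(add0n i.+1); apply: arrow_powM.
move=> Ry; apply/NE; move: y Ry; apply: radpow_act_ind =>
  // g z hg /IH [f hf ->].
by apply/NE; exists (g * f); [rewrite -add1n; apply: arrow_powM|rewrite actM].
Qed.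

Lemma frame_prefix_notin i : (i <= l)%N ->
  act (b_ (ptake i p)) x \notin radpow U i.+1.
Proof.
move=> il; apply/negP => /frame_radpow [f hf].
rewrite -prefix_comb_delta // => /esym /(frame_low hf) /(_ i (ltnSn i) il) /eqP.
by rewrite eqxx oner_eq0.
Qed.

Lemma frame_prefix_in i : (i <= l)%N -> act (b_ (ptake i p)) x \in radpow U i.
Proof.
move=> il; apply/frame_radpow; exists (b_ (ptake i p)) => //.
by apply: arrow_powU; rewrite plen_ptake.
Qed.

Lemma frame_top_element : top_element x.
Proof.
split; last by exists (pstart p); case: fx.
by have := frame_prefix_notin (leq0n l); rewrite ptake0; case: fx => ->.
Qed.

Lemma frame_peel i y : (i <= l)%N -> y \in radpow U i ->
  exists c : K, y - act c%:S (act (b_ (ptake i p)) x) \in radpow U i.+1.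
Proof.
move=> il /frame_radpow [f hf ->]; have [c -> c0] := frame_pow hf.
have [g hg ->] := prefix_comb_lead il c0.
exists (c i); apply/frame_radpow; exists g => //.
by rewrite actDl -actZl addrC addKr.
Qed.

Lemma frame_radpow_end y : y \in radpow U l.+1 -> y = 0.
Proof. by case: fx => _ _ _ kill /frame_radpow [f hf ->]; apply: kill. Qed.

Lemma frame_vsimple i : (i <= l)%N ->
  vsimple (pvertex p i) (subquot (radpow U i) (radpow U i.+1)).
Proof.
move=> il; apply: (@vsimple_subquot _ _ _ _ _ _ _ (act (b_ (ptake i p)) x)).
- by rewrite -actM -pend_ptake bpath_pend.
- exact: frame_prefix_in.
- exact: frame_prefix_notin.
- by move=> f hf; apply: radpow_act_step => //; apply: frame_prefix_in.
- by move=> y; apply: frame_peel.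
Qed.

Lemma radpow_le (i j : nat) : (i <= j)%N -> {subset radpow U j <= radpow U i}.
Proof.
move=> ij; rewrite -(subnK ij); elim: (j - i)%N => [|k IH] y //.
by rewrite addSn => /radpow_decr /IH.
Qed.

(** Descending induction from [J^(l+1) U = 0]: modulo the next radical power, every element of
    [J^j U] with [j >= i] is a multiple of the image of [y] under a subpath of [p]. *)
Lemma frame_submod (N : submodClosed U) y i c : y \in N -> (i <= l)%N ->
  y = act (prefix_comb p c) x -> (forall j, (j < i)%N -> c j = 0) -> c i <> 0 ->
  {subset radpow U i <= N}.
Proof.
move=> Ny il yc c0 ci; have [g hg cE] := prefix_comb_lead il c0.
suff H k : (k <= l.+1 - i)%N -> {subset radpow U (l.+1 - k) <= N}.
  by have := H _ (leqnn _); rewrite subKn // leqW.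
elim: k => [_|k IH kl] z.
  by rewrite subn0 => /frame_radpow_end ->; rewrite rpred0.
have kl' : (k <= l)%N by rewrite -ltnS (leq_trans kl) // leq_subr.
rewrite subSS; set j := (l - k)%N => Rz.
have ij : (i <= j)%N by rewrite /j leq_subRL // addnC -ltnS -ltn_subRL.
have jl : (j <= l)%N by apply: leq_subr.
have jE : (l.+1 - k)%N = j.+1 by rewrite subSn.
have [d zd] := frame_peel jl Rz.
(* The subpath from [i] to [j] carries the leading term of [y] to position [j]; the scalar adjusts
   its coefficient to [d]. *)
pose w := (d / c i) *: b_ (psub i j p).
rewrite -(subrK (act w y) z) rpredD ?act_in //.
apply: (IH (ltnW kl)); rewrite jE.
have -> : z - act w y = (z - act d%:S (act (b_ (ptake j p)) x)) - act (w * g) x.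
  rewrite -addrA -opprD; congr (_ - _).
  rewrite yc cE -actM mulrDr actDl; congr (_ + _).
  rewrite /w -pascalerAl -pascalerAr scalerA divfK; last exact/eqP.
  by rewrite bpath_psub // actZl.
apply: submodB => //; apply/frame_radpow; exists (w * g) => //.
rewrite -(subnK ij) -addnS; apply: arrow_powM => //;
  apply/arrow_powZ/arrow_powU.
by rewrite plen_psub // ij.
Qed.

Lemma frame_leading y : y <> 0 -> exists i c,
  [/\ (i <= l)%N, y = act (prefix_comb p c) x, forall j, (j < i)%N ->
    c j = 0 & c i <> 0].
Proof.
move=> y0; case: (fx) => _ _ gen _; have [c yc] := gen y.
have exc : exists i, (i <= l)%N && (c i != 0).
  apply: contrapT => nex; apply: y0; rewrite yc -(act0l x) -(prefix_comb0 p).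
  congr act; apply: eq_prefix_comb => i il; apply: contrapT => /eqP ci.
  by apply: nex; exists i; rewrite il.
case: (ex_minnP exc) => i /andP[il ci] min; exists i, c; split=> //;
  last exact/eqP.
move=> j ji; apply/eqP/negPn/negP => cj; have := min j.
by rewrite cj (leq_trans (ltnW ji)) // => /(_ isT); rewrite leqNgt ji.
Qed.

(** By [frame_submod] a nonzero element generates the radical power given by its leading index, and
    these powers form a chain. *)
Lemma frame_uniserial : uniserial U.
Proof.
move=> N N'; have [[y Ny N'y]|h] := pselect (exists2 y,
  y \in N & y \notin N'); last first.
  by left=> y Ny; apply/negPn/negP => N'y; apply: h; exists y.
right=> y' N'y'; have [->|y'0] := pselect (y' = 0); first exact: rpred0.
have y0 : y <> 0 by move=> y0; rewrite y0 rpred0 in N'y.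
have [i [c [il yc c0 ci]]] := frame_leading y0.
have [i' [c' [il' yc' c0' ci']]] := frame_leading y'0.
have RyP k (d : nat -> K) z : z = act (prefix_comb p d) x ->
    (forall j, (j < k)%N -> d j = 0) -> z \in radpow U k.
  by move=> -> d0; apply/frame_radpow; exists (prefix_comb p d) => //;
    apply: prefix_comb_pow.
have [i'i|ii'] := leqP i' i.
  case/negP: N'y; apply: (frame_submod N'y' il' yc' c0' ci').
  exact: (radpow_le i'i (RyP _ _ _ yc c0)).
apply: (frame_submod Ny il yc c0 ci).
exact: (radpow_le (ltnW ii') (RyP _ _ _ yc' c0')).
Qed.

Lemma frame_mast : mast_of p U.
Proof.
case: (fx) => _ px gen _; split; last by exists x.
- exists 1%N, (fun=> x) => y; have [c yc] := gen y.
  by exists (fun=> to_Lambda I (prefix_comb p c)); rewrite big_ord1.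
- exact: frame_uniserial.
exists (radpow U); split=> //; first exact: frame_radpow_end.
move=> i il; split; first exact: radpow_decr.
exact: (vsimple_simple (frame_vsimple il)).
Qed.

End FrameTheory.

(** Arrows kill the simple factors, hence descend along [N]. As [p x <> 0] and the chain has only
    [plen p + 1] factors, no prefix of [p] descends too fast, so the prefixes generate the
    successive factors. *)
Lemma chain_frame p U (N : nat -> submodClosed U) (x : U) :
  (forall y, y \in N 0) -> (forall y, y \in N (plen p).+1 -> y = 0) ->
  (forall i, (i < (plen p).+1)%N -> simple (subquot (N i) (N i.+1))) ->
  act (b_ (vpath (pstart p))) x = x -> act (b_ p) x <> 0 -> frame p x.
Proof.
set l := plen p => N0 Nl sN ex px.
have step i f y : (i < l.+1)%N -> pow 1 f -> y \in N i -> act f y \in N i.+1.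
  move=> il hf Ny; apply/(sqclass_eq0 _ (act_in f Ny)).
  rewrite -(@sqclassZ _ _ _ _ _ _ Ny); exact: (simple_pow adm (sN i il)).
have filt := filtration_act step.
have kill f : pow l.+1 f -> forall y : U, act f y = 0.
  by move=> hf y; apply: Nl; rewrite -(add0n l.+1); apply: filt.
have vin i : (i <= l)%N -> act (b_ (ptake i p)) x \in N i.
  move=> il; rewrite -{2}(add0n i); apply: filt => //; first exact: leqW.
  by apply: arrow_powU; rewrite plen_ptake.
have vnot i : (i <= l)%N -> act (b_ (ptake i p)) x \notin N i.+1.
  move=> il; apply/negP => vi; apply: px; rewrite -(bpath_pdrop K i p) actM.
  have lE : (i.+1 + (l - i) = l.+1)%N by rewrite addSn subnKC.
  apply: Nl; rewrite -lE; apply: filt => //; first by rewrite lE.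
  by apply: arrow_powU; rewrite plen_pdrop.
split=> // y.
suff H k : (k <= l.+1)%N -> forall y, y \in N (l.+1 - k)%N ->
    exists c, y = act (prefix_comb p c) x.
  by apply: (H l.+1) => //; rewrite subnn.
elim: k => [_|k IH kl] {}y.
  by rewrite subn0 => /Nl ->; exists (fun=> 0); rewrite prefix_comb0 act0l.
rewrite subSS; set i := (l - k)%N => Ny.
have il : (i <= l)%N by apply: leq_subr.
have iE : (l.+1 - k)%N = i.+1 by rewrite subSn.
have [a] := simple_subquot_gen (sN i il) (vin i il) (vnot i il) Ny.
have [f -> Nyf] := to_Lambda_surj a.
have [] := IH (ltnW kl)
  (y - act (pcoef (vpath (pvertex p i)) f)%:S (act (b_ (ptake i p)) x)).
  rewrite iE -(subrK (act f (act (b_ (ptake i p)) x)) y) -addrA rpredD //.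
  rewrite (@act_const _ _ _ _ (pvertex p i));
    last by rewrite -actM -pend_ptake bpath_pend.
  rewrite addrAC subrr add0r.
  by apply: step => //; [exact: radpart_pow|exact: vin].
(* The coefficient of [f] at the vertex reached: the rest of [f] acts into the next term of the
   chain. *)
move=> c yc; pose d := pcoef (vpath (pvertex p i)) f.
exists (fun j => c j + d * (j == i)%:R).
rewrite prefix_combD prefix_combZ prefix_comb_delta // actDl -yc.
by rewrite [act (d *: _) x]actZl subrK.
Qed.

Lemma mast_frame p U : mast_of p U -> exists x : U, frame p x.
Proof.
case=> _ _ [N [N0 Nl sN]] [y py]; exists (act (b_ (vpath (pstart p))) y).
apply: (@chain_frame _ _ N) => //.
- by move=> i il; case: (sN i il).
- by rewrite -actM vpathM eqxx scale1r.
- by rewrite -actM bpath_pstart.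
Qed.

(** Expanded in a known frame, [x] has nonzero constant coefficient because it is outside [J U], and
    [p x] is that multiple of [p x0]. Then [p x <> 0] forces the vertex of [x] to be the start of
    [p]. *)
Lemma mast_top_frame p U (x : U) : mast_of p U -> top_element x -> frame p x.
Proof.
move=> mU [x1 [e ex]]; have [x0 fx0] := mast_frame mU.
case: (fx0) => ex0 px0 gen0 kill0; case: mU => _ _ [N [N0 Nl sN]] _.
have [c xc] := gen0 x.
have px : act (b_ p) x <> 0.
  move=> px; case/negP: x1; apply/(frame_radpow fx0);
    exists (prefix_comb p c) => //.
  apply: prefix_comb_pow => -[|//] _; apply: (act_scal_eq0 _ px0).
  have [|//|g hg cE] := @prefix_comb_lead p c 0; first by [].
  move: px; rewrite xc cE ptake0 -actM mulrDr actDl -pascalerAr bpath_pstart.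
  rewrite actZl [X in _ + X]kill0 ?addr0 //.
  by rewrite -addn1; apply: arrow_powM => //; apply: arrow_powU.
apply: (@chain_frame _ _ N) => //; first by move=> i il; case: (sN i il).
have [es|ne] := eqVneq e (pstart p); first by rewrite -es; exact/esym/ex.
case: px; rewrite ex -[_ *: x]/(act _ x) -actM -(bpath_pstart K p) -mulrA
  vpathM.
by rewrite eq_sym (negPf ne) scale0r mulr0 act0l.
Qed.

End Frames.

(** * Subpaths of masts *)

Section Masts.
Variables (K : fieldType) (Q : quiver) (I : ideal (path_algebra K Q)).
Hypothesis adm : admissible I.
Local Notation KQ := (path_algebra K Q).
Local Notation L := (Lambda I).
Local Notation b_ := (bpath K).
Local Notation "c %:S" := (c *: (1 : KQ)) (at level 2, format "c %:S").
Local Notation pow := (@arrow_ideal_pow K Q).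
Implicit Types (f g : KQ) (U V W : lmodType L) (p : qpath Q) (c : nat -> K).

Lemma ptake_psub i j k p : (k <= j - i)%N ->
  ptake k (psub i j p) = psub i (i + k) p.
Proof.
move=> kj; apply: qpath_eq => //.
by rewrite [LHS]/parrows /= !parrows_psub addKn take_takel.
Qed.

Lemma prefix_comb_psub i j p c : (i <= j <= plen p)%N ->
  prefix_comb (psub i j p) (fun k => c (i + k)%N) * b_ (ptake i p) =
  prefix_comb p (fun k => if (i <= k <= j)%N then c k else 0).
Proof.
move=> h; have /andP[ij jl] := h; rewrite /prefix_comb plen_psub // mulr_suml.
rewrite (@big_cat_nat _ _ _ j.+1 0 (plen p).+1) //=.
rewrite (@big_cat_nat _ _ _ i 0 j.+1) //= ?leqW //.
rewrite [X in X + _ + _]big_nat [X in X + _ + _]big1 ?add0r; last first.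
  by move=> k /andP[_ ki]; rewrite [(i <= k)%N]leqNgt ki scale0r.
rewrite [X in _ + X]big_nat [X in _ + X]big1 ?addr0; last first.
  by move=> k /andP[jk _]; rewrite [(k <= j)%N]leqNgt jk andbF scale0r.
rewrite -[X in index_iota X j.+1]add0n big_addn subSn // big_nat [RHS]big_nat.
apply: eq_bigr => k /andP[_ kj]; rewrite ltnS in kj.
have -> : (k + i <= j)%N by rewrite addnC -leq_subRL.
by rewrite leq_addl /= ptake_psub // -pascalerAl bpath_psub ?leq_addr // addnC.
Qed.

(** The witness is [J^i U / J^(j+1) U], generated by the class of [ptake i p] applied to [x]. *)
Lemma mast_psub i j p : mast I p -> (i <= j <= plen p)%N -> mast I (psub i j p).
Proof.
move=> [U /(mast_frame adm) [x fx]] h; have /andP[ij jl] := h.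
have il := leq_trans ij jl.
set N := radpow U i; set N' := radpow U j.+1.
have vN := frame_prefix_in adm fx il.
exists (subquot N N'); apply: (@frame_mast _ _ _ adm _ _ (sqclass N' vN)).
have actC f y (Ny : y \in N) : act f (sqclass N' Ny) = sqclass N' (act_in f Ny).
  exact: sqclassZ.
split.
- rewrite actC; apply: sqclass_eqS.
  by rewrite -actM pstart_psub -pend_ptake bpath_pend.
- rewrite actC => /sqclass_eq0; rewrite -actM bpath_psub //; apply/negP.
  exact: (frame_prefix_notin adm fx).
- move=> z; have [y [Ny ->]] := sqclass_surj z.
  have /(frame_radpow adm fx) [f hf yf] := Ny.
  have [c fc c0] := frame_pow fx hf.
  (* Coefficients below [i] vanish because [y] lies in [J^i U]; those above [j] are absorbed by
     [N']. *)
  exists (fun k => c (i + k)%N); rewrite actC; apply/sqclass_eq.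
  rewrite -actM prefix_comb_psub // yf fc -actBl -prefix_combB.
  apply/(frame_radpow adm fx); eexists; last by
  []. apply: prefix_comb_pow => k; rewrite ltnS => kj; rewrite kj andbT.
  by case: leqP => [|ki]; rewrite ?subrr // c0 // subrr.
move=> f; rewrite plen_psub // => hf z; have [y [Ny ->]] := sqclass_surj z.
rewrite actC; apply/sqclass_eq0; rewrite /N' -(subnKC ij) -addnS.
exact: radpow_filtration.
Qed.

(** * Points of V_p and the modules they determine *)

Section Realization.
Variable p : qpath Q.
Let l := plen p.
Implicit Types (k : {ffun detour_index p -> K}) (d : detour_index p).

Definition detour_comb k a u : KQ :=
  \sum_(d | (darrow d == a) && (dsub d == u)) k d *: b_ (dlong d).

Definition realizes k U (x : U) : Prop := forall a u, detour p a u ->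
  act (b_ (apath a) * b_ u) x = act (detour_comb k a u) x.

Lemma VpP k : Vp I k <->
  exists (U : lmodType L) (x : U), frame p x /\ realizes k x.
Proof.
split=> [[U [x [mU tx rx]]]|[U [x [fx rx]]]]; exists U, x.
  split; first exact: mast_top_frame.
  by move=> a u dau; rewrite /detour_comb [RHS]act_suml; apply: rx.
split; [exact: (frame_mast adm fx)|exact: (frame_top_element adm fx)|].
by move=> a u /rx; rewrite /detour_comb [RHS]act_suml.
Qed.

(** The coordinate of the triple [(a, u, j)]; at most one index contributes, and the sum is 0 if
    there is none. *)
Definition detour_coef k a u (j : nat) : K :=
  \sum_(d | (darrow d == a) && (dsub d == u) && ((val d).2 == j :> nat)) k d.

Lemma detour_combE k a u : detour_comb k a u = prefix_comb p (detour_coef k a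
  u).
Proof.
rewrite /detour_comb (partition_big (fun d => (val d).2) xpredT) //=.
rewrite /prefix_comb big_mkord; apply: eq_bigr => j _.
rewrite /detour_coef scaler_suml; apply: eq_bigr => d /andP[_ /eqP dj].
by rewrite /dlong dj.
Qed.

Lemma detour_index_inj d d' : darrow d = darrow d' -> dsub d = dsub d' ->
  (val d).2 = (val d').2 -> d = d'.
Proof.
case: d d' => [[[a i] j] h] [[[a' i'] j'] h']; rewrite /darrow /dsub /=.
move=> ea /ptake_inj eu ej; apply: val_inj => /=; rewrite ea ej; congr (_, _,
  _).
by apply: val_inj; apply: eu; rewrite -ltnS.
Qed.

Lemma detour_coef_index k d : detour_coef k (darrow d) (dsub d) (val d).2 = k d.
Proof.
rewrite /detour_coef (bigD1 d) ?eqxx //= big1 ?addr0 // => d'.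
case/andP=> /andP[/andP[/eqP ea /eqP eu] /eqP ej] /eqP [];
  apply: detour_index_inj => //.
exact: val_inj.
Qed.

Lemma detour_dindex d : detour p (darrow d) (dsub d).
Proof. by have /and3P[] := valP d. Qed.

Lemma dsub_lt_dlong d : ((val d).1.2 < (val d).2)%N.
Proof. by have /and3P[] := valP d. Qed.

Lemma pvertex_dlong d : pvertex p (val d).2 = tgt (darrow d).
Proof. by have /and3P[_ _ /eqP] := valP d. Qed.

Lemma dindex_ex a (i j : nat) : detour p a (ptake i p) -> (i < j)%N ->
  (j <= l)%N ->
  pvertex p j = tgt a ->
  exists d, [/\ darrow d = a, dsub d = ptake i p & (val d).2 = j :> nat].
Proof.
move=> da ij jl pj.
have il : (i < l.+1)%N by rewrite ltnS (leq_trans (ltnW ij)).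
have h : [&& detour p a (ptake (Ordinal il) p), (Ordinal il < Ordinal (jl :
  j < l.+1)%N)%N &
    pend (ptake (Ordinal (jl : j < l.+1)%N) p) == tgt a].
  by rewrite da ij /= pend_ptake pj eqxx.
by exists (exist _ (a, Ordinal il, Ordinal (jl : j < l.+1)%N) h).
Qed.

Lemma detour_coef_out k a (i j : nat) : (i <= l)%N ->
  (j <= i)%N || (pvertex p j != tgt a) -> detour_coef k a (ptake i p) j = 0.
Proof.
move=> il hj; apply: big1 => d /andP[/andP[/eqP ea /eqP eu] /eqP ej].
have di : (val d).1.2 = i :> nat by apply: (ptake_inj _ il eu); rewrite -ltnS.
case/orP: hj => [|/eqP]; first by rewrite leqNgt -di -ej dsub_lt_dlong.
by rewrite -ea -pvertex_dlong -ej.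
Qed.

Lemma detour_arrow a u : detour p a u ->
  [/\ u = ptake (plen u) p, (plen u <= l)%N & src a = pvertex p (plen u)].
Proof.
case/and3P=> /right_subpathE [e ul]; case E: Defs.pcomp => [w|//] _ _.
split=> //; move/pcompP: E => [eq _].
by rewrite -[src a]/(pstart (apath a)) -eq -pend_ptake -e.
Qed.

Lemma frame_realizes U (x : U) : frame p x -> exists k, realizes k x.
Proof.
(* All pairs of an arrow and a length are expanded at once, so that [choice] applies; nothing is
   claimed about vanishing for lengths beyond [l]. *)
move=> fx; have H (ai : arrow Q * nat) : exists c : nat -> K,
    act (b_ (apath ai.1) * b_ (ptake ai.2 p)) x = act (prefix_comb p c) x /\
    forall j, (ai.2 <= l)%N -> (j < ai.2.+1)%N || (pvertex p j != tgt ai.1) ->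
      (j <= l)%N -> c j = 0.
  case: ai => a i /=; have [il|li] := leqP i l; last first.
    by case: (fx) => _ _ gen _; have [c ec] :=
      gen (act (b_ (apath a) * b_ (ptake i p)) x); exists c.
  have [||c [ec c0]] := @frame_expand _ _ _ _ _ _ fx (tgt a) i.+1 (b_ (apath a)
    * b_ (ptake i p)).
  - by rewrite mulrA; congr (_ * _); apply: (bpath_pend K (apath a)).
  - by rewrite -add1n; apply: arrow_powM; apply: arrow_powU;
    rewrite ?plen_ptake.
  by exists c; split=> // j _; apply: c0.
have [C CE] := choice H; pose k : {ffun detour_index p -> K} :=
  [ffun d => C (darrow d, val (val d).1.2) (val (val d).2)].
exists k => a u da; have [ue ul _] := detour_arrow da; set i := plen u in ue ul.
have [/= ec c0] := CE (a, i); rewrite ue ec detour_combE; congr act.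
apply: eq_prefix_comb => j jl.
have [ji|ij] := leqP j i.
  by rewrite detour_coef_out ?ji // c0 // ltnS ji.
have [pj|pj] := eqVneq (pvertex p j) (tgt a); last first.
  by rewrite detour_coef_out ?pj ?orbT // c0 // pj orbT.
rewrite ue in da; have [d [ea eu ej]] := dindex_ex da ij jl pj.
rewrite -ea -eu -ej detour_coef_index ffunE; congr (C (_, _) _).
by apply/esym/(ptake_inj _ ul eu); rewrite -ltnS.
Qed.

(** [P f] says that [f x] and [f w] have the same coordinates. An arrow after a prefix of [p] gives
    a longer prefix, a detour governed by [k], or zero, so [P] holds for all [f]; then [x] and [w]
    have the same annihilator. *)
Lemma frame_iso k U W (x : U) (w : W) : frame p x -> frame p w ->
  realizes k x -> realizes k w -> isomorphic U W.
Proof.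
move=> fx fw rx rw.
pose P f := exists c, act f x = act (prefix_comb p c) x /\ act f w = act
  (prefix_comb p c) w.
have PD f g : P f -> P g -> P (f + g).
  move=> [c [cx cw]] [d [dx dw]]; exists (fun i => c i + d i).
  by rewrite prefix_combD !actDl cx cw dx dw.
have P0 : P 0 by exists (fun=> 0); rewrite prefix_comb0.
have PZ a f : P f -> P (a *: f).
  move=> [c [cx cw]]; exists (fun i => a * c i).
  by rewrite prefix_combZ; split; rewrite [LHS]actZl [RHS]actZl ?cx ?cw.
have Pv i : (i <= l)%N -> P (b_ (ptake i p)).
  by move=> il; exists (fun j => (j == i)%:R); rewrite prefix_comb_delta.
have Pav a i : (i <= l)%N -> P (b_ (apath a) * b_ (ptake i p)).
  move=> il; have [sa|sa] := eqVneq (src a) (pvertex p i); last first.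
    by rewrite bpathM_neq //; apply/eqP.
  have bc : b_ (apath a) * b_ (ptake i p) = 0 ->
    P (b_ (apath a) * b_ (ptake i p)).
    by move=> ->.
  case E: (Defs.pcomp (apath a) (ptake i p)) => [v|]; last first.
    by apply: bc; rewrite bpathM /pmul E.
  have [vp|vp] := boolP (right_subpath v p).
    rewrite bpathM /pmul E; have [ve vl] := right_subpathE vp. rewrite ve;
      exact: Pv.
  have [ex|nex] := boolP [exists j : 'I_(plen p).+1,
    (plen (ptake i p) < j)%N && (pend (ptake j p) == tgt a)].
    have da : detour p a (ptake i p) by rewrite /detour ptake_right_subpath E
      vp ex.
    have : P (detour_comb k a (ptake i p)).
      apply: big_ind => // d _; apply/PZ/Pv; rewrite -ltnS; exact: ltn_ord.
    by move=> [c [cx cw]]; exists c; rewrite rx // rw.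
  (* No longer right subpath ends at the target of [a], so the expansion in any frame is empty. *)
  suff z V (y : V) : frame p y -> act (b_ (apath a) * b_ (ptake i p)) y = 0.
    by exists (fun=> 0); rewrite prefix_comb0 !act0l !z.
  move=> fy; have [||c [-> c0]] := @frame_expand _ _ _ _ _ _ fy (tgt a) i.+1
    (b_ (apath a) * b_ (ptake i p)).
  - by rewrite mulrA; congr (_ * _); apply: (bpath_pend K (apath a)).
  - by rewrite -add1n; apply: arrow_powM; apply: arrow_powU;
    rewrite ?plen_ptake.
  rewrite -(act0l y) -(prefix_comb0 K p); congr act; apply: eq_prefix_comb =>
    j jl.
  apply: c0 => //; rewrite ltnNge -negb_and; apply: contra nex => /andP[ij pj].
  by apply/existsP; exists (Ordinal (jl : (j < l.+1)%N));
    rewrite plen_ptake //= ij.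
have Pa a f : P f -> P (b_ (apath a) * f).
  move=> [c [cx cw]]; have : P (b_ (apath a) * prefix_comb p c).
    rewrite /prefix_comb big_mkord mulr_sumr; apply: big_ind => // i _.
    by rewrite -pascalerAr; apply/PZ/Pav; rewrite -ltnS.
  by move=> [d]; rewrite !actM -cx -cw => h; exists d; rewrite !actM.
have Pall f : P f.
  (* A path is built up arrow by arrow from its start vertex, which acts as the identity or as zero
     on [x] and [w]. *)
  elim/pa_ind: f => // q; rewrite
  -[q]ptake_plen. elim: {-2}(plen q) (leqnn (plen q)) => [_|j IH jq].
    exists (fun i => (pstart q == pstart p)%:R * (i == 0)%:R).
    rewrite prefix_combZ prefix_comb_delta // !ptake0.
    case: (fx) => ex _ _ _; case: (fw) => ew _ _ _.
    rewrite -{1}ex -{1}ew -!actM !vpathM.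
    case: eqP => [->|_]; last by rewrite !scale0r !act0l.
    by rewrite !scale1r.
  case ep: (parrows q) => [|a t]; first by move: jq; rewrite /plen ep.
  rewrite -(bpath_step K a jq); exact/Pa/IH/ltnW.
have zero c V (y : V) : frame p y -> act (prefix_comb p c) y = 0 <-> forall j,
  (j <= l)%N -> c j = 0.
  move=> fy; split=> [h j jl|c0].
    by apply: (frame_uniq (d := fun=> 0) fy _ jl); rewrite prefix_comb0 act0l.
  rewrite -(act0l y) -(prefix_comb0 K p); congr act; exact: eq_prefix_comb.
apply: (@isomorphic_act _ _ _ _ _ x w).
- by move=> y; case: fx => _ _ gen _; have [c ->] := gen y;
  exists (prefix_comb p c).
- by move=> y; case: fw => _ _ gen _; have [c ->] := gen y;
  exists (prefix_comb p c).
move=> f; have [c [-> ->]] := Pall f.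
by split=> [/(zero c _ _ fx)/(zero c _ _ fw)|/(zero c _ _ fw)/(zero c _ _ fx)].
Qed.

End Realization.

(** * Composition series and masts *)

Section Series.
Variables (l : nat) (S : 'I_l.+1 -> lmodType L).
Hypothesis simS : forall i, simple (S i).

(** Some path of length [l] acts nontrivially, as otherwise [J^l U = 0]. The radical layers then
    identify its vertices. *)
Lemma series_mast U : has_series S U -> exists2 q,
  path_through S q & mast_of q U.
Proof.
move=> [fgU uU hl iso]; case: (hl) => N [N0 Nl sN].
have step i f (y : U) : (i < l.+1)%N -> pow 1 f -> y \in N i ->
  act f y \in N i.+1.
  move=> il hf Ny; have [_ si] := sN i il.
  apply/(sqclass_eq0 _ (act_in f Ny)).
  rewrite -(@sqclassZ _ _ _ _ _ _ Ny); exact: (simple_pow adm si).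
have RN i : (i <= l.+1)%N -> {subset radpow U i <= N i}.
  elim: i => [_ y _ //|i IH il]; apply: (radpow_act_ind adm) => f y hf Ry.
  by apply: step => //; apply: IH; rewrite // ltnW.
have [q ql [x qx]] : exists2 q, plen q = l & exists x : U, act (b_ q) x <> 0.
  apply: contrapT => nex.
  have kill f : pow l f -> forall y : U, act f y = 0.
    move=> hf y; elim/(@arrow_pow_ind K Q l): f / hf =>
      [|f g hf hg|c f hf|q lq].
    - by rewrite act0l.
    - by rewrite actDl hf hg addr0.
    - by rewrite actZl hf act0r.
    rewrite -(bpath_pdrop K l q) actM; apply: contrapT => h; apply: nex.
    exists (ptake l q); first by rewrite plen_ptake.
    by exists y => h0; apply: h; rewrite h0 act0r.
  (* If [U] is killed by paths of length [l], then [J^i U] is killed by those of length [l - i]; for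
     [i = l] this reads [J^l U = 0]. *)
  have Rk i : (i <= l)%N -> forall y, y \in radpow U i -> forall f,
    pow (l - i) f -> act f y = 0.
    elim: i => [_ y _ f|i IH il y Ry]; first by rewrite subn0; move/kill.
    have [|||M ME] := @ex_submod_act _ _ _ U (fun y => forall f,
      pow (l - i.+1) f -> act f y = 0).
    - by move=> f _; rewrite act0r.
    - by move=> y1 y2 h1 h2 f hf; rewrite actDr h1 // h2 // addr0.
    - move=> g z hz f hf; rewrite -actM; apply: hz; rewrite -(addn0 (l - _)%N).
      exact: arrow_powM.
    apply/ME; move: y Ry; apply: (radpow_act_ind adm) => g z hg Rz; apply/ME =>
      f hf.
    rewrite -actM; apply: (IH (ltnW il) z Rz).
    by rewrite (_ : (l - i = l - i.+1 + 1)%N);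
      [apply: arrow_powM|rewrite addn1 subnSK].
  (* The last layer would be zero, although it is isomorphic to a simple module. *)
  have [h [h' hK h'K]] := iso ord_max; have [[s s0] _] := simS ord_max.
  apply: s0; rewrite -(h'K s); have [y [Ry ->]] := sqclass_surj (h' s).
  rewrite (_ : sqclass _ _ = 0) ?linear0 //; apply/sqclass_eq0.
  have -> : y = 0; last exact: rpred0.
  by rewrite -(act1 y); apply: (Rk l) => //; rewrite subnn.
have mU : mast_of q U by split; rewrite ?ql //; exists x.
exists q => //; split=> // i; have [x0 fx0] := mast_frame adm mU.
have il : (i <= plen q)%N by rewrite ql -ltnS.
apply: (isomorphic_trans (isomorphic_sym (iso i))).
exact: (vsimple_iso (frame_vsimple adm fx0 il) (vsimple_Svertex adm _)).
Qed.

Lemma mast_series q U : path_through S q -> mast_of q U -> has_series S U.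
Proof.
move=> [ql vq] mU; have [x fx] := mast_frame adm mU.
case: mU => fgU uU hl _; split=> //; first by rewrite -ql.
move=> i; have il : (i <= plen q)%N by rewrite ql -ltnS.
apply: isomorphic_trans (isomorphic_sym (vq i)).
exact: (vsimple_iso (frame_vsimple adm fx il) (vsimple_Svertex adm _)).
Qed.

Lemma path_through_vsimple q i : path_through S q -> vsimple (pvertex q (i :
  'I_l.+1)) (S i).
Proof.
move=> [_ vq]; exact: (vsimple_transfer (isomorphic_sym (vq i))
  (vsimple_Svertex adm _)).
Qed.

End Series.

(** Without a loop at [e], a lift of the generator [v] fixed by [e] is killed by all arrows, so it
    spans a copy of [V] and the extension splits. *)
Lemma Ext1_loop e V : vsimple e V -> Ext1_neq0 V V ->
  exists2 g : arrow Q, src g = e & tgt g = e.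
Proof.
move=> [v [v0 ev rv gv]] [E nE]; apply: contrapT => nloop; apply: nE.
have [y0 y0v] := ext_projP E v; pose y := act (b_ (vpath e)) y0.
have yv : ext_proj E y = v by rewrite act_lin y0v.
have ey : act (b_ (vpath e)) y = y by rewrite -actM vpathM eqxx scale1r.
(* [a y] lies in the image of [V], where [e] acts as the identity, but it is supported at the end of
   [a], which differs from [e]. *)
have ay a : act (b_ (apath a)) y = 0.
  have [sa|sa] := eqVneq (src a) e; last first.
    by rewrite -ey -actM bpathM_neq ?act0l //; apply/eqP.
  have [w wE] : exists w, act (b_ (apath a)) y = ext_inj E w.
    by apply/ext_exact; rewrite act_lin yv rv //; apply: arrow_powU.
  have ta : tgt a <> e by move=> ta; apply: nloop; exists a.
  have tw : act (b_ (apath a)) y = act (b_ (vpath (tgt a))) (ext_inj E w).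
    rewrite -wE -actM; congr act; exact/esym/(bpath_pend K (apath a)).
  have [c wc] := gv w; rewrite tw wc -act_lin -ev -!actM.
  rewrite -mulrA -pascalerAl mul1r -pascalerAr vpathM; case: eqP => // _.
  by rewrite scale0r scaler0 act0l linear0.
have ry f : pow 1 f -> act f y = 0.
  move=> hf; elim/(@arrow_pow_ind K Q 1): f / hf => [|f g hf hg|c f hf|q lq].
  - by rewrite act0l.
  - by rewrite actDl hf hg addr0.
  - by rewrite actZl hf act0r.
  case ep: (parrows q) => [|a t]; first by move: lq; rewrite /plen ep.
  rewrite -(bpath_pdrop K 1 q) -(bpath_step K a lq) !actM ptake0.
  have [es|es] := eqVneq (pstart q) e; first by rewrite es ey ay act0r.
  by rewrite -ey -(actM _ _ y) vpathM (negPf es) scale0r act0l !act0r.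
have fy f : act f y = act (pcoef (vpath e) f)%:S y by apply: vsimple_act.
have fv f : act f v = act (pcoef (vpath e) f)%:S v by apply: vsimple_act.
have [cs csE] := choice gv.
(* A section of the projection, sending [v] to [y]. *)
pose s z := act (cs z)%:S y.
have sact f : s (act f v) = act f y.
  suff cE : cs (act f v) = pcoef (vpath e) f by rewrite /s cE -fy.
  apply/eqP; rewrite -subr_eq0; apply/eqP; apply: (act_scal_eq0 _ v0).
  by rewrite scalerBl actBl -csE -fv subrr.
have sp z : ext_proj E (s z) = z by rewrite act_lin yv -csE.
have sD z z' : s (z + z') = s z + s z'.
  by rewrite (csE z) (csE z') -actDl !sact actDl.
have sA f z : s (act f z) = act f (s z) by rewrite (csE z) -actM !sact actM.
have rE x : exists w, x - s (ext_proj E x) = ext_inj E w.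
  by apply/ext_exact; rewrite linearB /= sp subrr.
have [r rE'] := choice rE.
(* The equivalence with the split extension: the difference [x - s (ext_proj E x)], read in the
   submodule, and the projection. *)
pose h (x : ext_mid E) : (V * V)%type := (r x, ext_proj E x).
have hl : linear h.
  move=> a x x'; have [f ->] := to_Lambda_surj a.
  rewrite /h; apply: (congr2 pair); last by rewrite linearP.
  apply: (@ext_injP _ _ _ E); rewrite linearP -!rE'.
  rewrite linearP sD -[_ *: ext_proj E x]/(act f _) sA scalerBr opprD addrACA.
  by [].
pose hL : {linear ext_mid E -> (V * V)%type} :=
  HB.pack h (GRing.isLinear.Build _ _ _ _ h hl).
exists hL; split=> //= w; rewrite /hL /= /h.
have p0 : ext_proj E (ext_inj E w) = 0 by apply/ext_exact; exists w.
have s0 : s 0 = 0 by rewrite -(act0l v) sact act0l.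
apply: (congr2 pair) => //; apply: (@ext_injP _ _ _ E).
by rewrite -rE' p0 s0 subr0.
Qed.

(** * Consequences of (N) *)

Section ConditionN.
Hypothesis condN : conditionN I.

(** (N) for the subpath between positions [i] and [j], whose last arrow has index [j - 1] in [p].
    Both indices are in range, so the default [a] is harmless. *)
Lemma conditionN_nth p (i j : nat) a : mast I p -> (i < j)%N ->
  (j <= plen p)%N ->
  src a = pvertex p i -> tgt a = pvertex p j ->
  nth a (parrows p) i = a \/ nth a (parrows p) j.-1 = a.
Proof.
move=> mp ij jl sa ta; have h : (i <= j <= plen p)%N by rewrite ltnW.
have lE : plen (psub i j p) = (j - i)%N by apply: plen_psub.
have [] := @condN a (psub i j p) (mast_psub mp h).
- by rewrite lE subn_gt0.
- by rewrite pstart_psub.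
- by rewrite pend_psub.
- move=> [w /bpath_starts hd]; left; move: hd; rewrite parrows_psub.
  by rewrite (drop_nth a) ?(leq_trans ij) // -(subnSK ij) => -[].
move=> [w /bpath_ends [t ht]]; right.
have j0 : (0 < j)%N by apply: leq_ltn_trans ij.
have ij1 : (i <= j.-1)%N by rewrite -ltnS prednK.
have st : size t = (j.-1 - i)%N.
  apply: succn_inj; rewrite -(size_rcons t a) -ht -/(plen (psub i j p)) lE.
  by rewrite -subSn // prednK.
have := congr1 (fun s => nth a s (size t)) ht.
rewrite nth_rcons ltnn eqxx parrows_psub nth_take ?nth_drop st.
  by rewrite subnKC.
by rewrite -[X in (_ < X - _)%N](prednK j0) subSn.
Qed.

(** An arrow of a mast is itself a mast of length one, so (N) identifies it with any parallel
    arrow. *)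
Lemma conditionN_parallel p a b : mast I p -> a \in parrows p ->
  src a = src b -> tgt a = tgt b -> a = b.
Proof.
move=> mp ap ab tab; set i := index a (parrows p).
have il : (i < plen p)%N by rewrite /plen index_mem.
have na a0 : nth a0 (parrows p) i = a by apply: nth_index.
have := @conditionN_nth p i i.+1 b mp (ltnSn i) il.
rewrite /= na; case=> //; first by rewrite -(src_nth b il) na.
by rewrite (pvertexS b il) na.
Qed.

(** The simple modules determine the vertices, and along the mast [p] the vertices determine the
    arrows. *)
Lemma path_through_unique l (S : 'I_l.+1 -> lmodType L) p q :
  mast I p -> path_through S p -> path_through S q -> p = q.
Proof.
move=> mp Sp Sq; case: (Sp) (Sq) => pl _ [ql _].
apply: pvertex_ext; first by rewrite pl.
  move=> i; rewrite pl -ltnS => il.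
  exact: (vsimple_uniq (path_through_vsimple (Ordinal il) Sp)
    (path_through_vsimple (Ordinal il) Sq)).
by move=> a b ap; apply: conditionN_parallel ap.
Qed.

End ConditionN.
End Masts.

(** * Slack variables as coordinates with infinitely many values *)

Section Coordinates.
Variables (K : fieldType) (Q : quiver) (I : ideal (path_algebra K Q)).
Variable p : qpath Q.
Implicit Types (k : {ffun detour_index p -> K}) (d : detour_index p).

Lemma coord_image_eq0 f : coord_image I f = 0 <->
  forall k, Vp I k -> f.@[fun i => k (enum_val i)] = 0.
Proof.
rewrite /coord_image rproj_eq0; split=> [/asboolP //|h]; exact/asboolP.
Qed.

Lemma coord_image_dvar d : coord_image I (dvar K d) = 0 <->
  forall k, Vp I k -> k d = 0.
Proof.
by split=> [/coord_image_eq0 h k /h|h]; [|apply/coord_image_eq0 => k /h];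
  rewrite /dvar mevalXU enum_rankK.
Qed.

(** At a point [k] the substituted polynomial takes the value [f.[k d]], so transcendence says that
    no nonzero polynomial kills all values of the coordinate. *)
Lemma slack_variableP d : slack_variable I d <->
  forall f : {poly K}, f != 0 -> exists2 k, Vp I k & f.[k d] <> 0.
Proof.
have E (f : {poly K}) k :
    ((map_poly (fun c : K =>
      c%:MP_[#|{: detour_index p}|]) f).[dvar K d]).@[fun i => k (enum_val i)]
      = f.[k d].
  rewrite -horner_map /= /dvar mevalXU enum_rankK -map_poly_comp_id0 ?rmorph0
    //=.
  by rewrite map_poly_id // => c _ /=; rewrite mevalC.
split=> h f f0.
  apply: contrapT => nk; apply: (h f f0); apply/coord_image_eq0 => k Vk.
  by rewrite E; apply: contrapT => fk; apply: nk; exists k.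
have [k Vk fk] := h f f0 => /coord_image_eq0 /(_ k Vk); rewrite E.
exact: fk.
Qed.

Lemma slack_variable_halyard d : slack_variable I d ->
  slack_halyard I p (darrow d) (dsub d).
Proof.
move=> sd; split; last by exists d.
split; first exact: detour_dindex.
exists d; split=> // /coord_image_dvar h.
have [|k Vk] := (slack_variableP d).1 sd 'X; first by rewrite polyX_eq0.
by rewrite hornerX h.
Qed.

End Coordinates.

(** Confines the values of a coordinate that is not slack to a finite list. *)
Lemma poly_roots_seq (K : fieldType) (f : {poly K}) : f != 0 ->
  exists L : seq K, forall x, root f x -> x \in L.
Proof.
elim: {f}(size f) {-2}f (leqnn (size f)) => [|n IH] f sf f0.
  by move: sf; rewrite leqn0 size_poly_eq0 (negPf f0).
have [[a fa]|nr] := pselect (exists a, root f a); last first.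
  by exists [::] => x fx; case: nr; exists x.
have /factor_theorem [q fq] := fa.
have q0 : q != 0 by apply: contra f0 => /eqP q0; rewrite fq q0 mul0r.
have [|L LP] := IH q _ q0.
  by move: sf; rewrite fq size_Mmonic ?monicXsubC // size_XsubC addn2.
exists (a :: L) => x; rewrite fq rootM root_XsubC inE => /orP[/LP ->|->] //.
by rewrite orbT.
Qed.

(** * Paths that loop and then leave *)

Section Shape.
Variables (K : fieldType) (Q : quiver) (I : ideal (path_algebra K Q)).
Hypothesis adm : admissible I.
Local Notation KQ := (path_algebra K Q).
Local Notation L := (Lambda I).
Local Notation b_ := (bpath K).
Local Notation "c %:S" := (c *: (1 : KQ)) (at level 2, format "c %:S").
Local Notation pow := (@arrow_ideal_pow K Q).
Implicit Types (f : KQ) (U V W : lmodType L).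

Section Leave.
Variables (p : qpath Q) (g : arrow Q) (mu : nat) (s : seq (arrow Q)).
Hypothesis shape : loop_then_leave p g mu s.
Let e := pstart p.
Let l := plen p.

Lemma leave_plen : l = (mu + size s)%N.
Proof. by case: shape => _ _ ap _ _; rewrite /l /plen ap size_cat size_nseq.
  Qed.

Lemma leave_mu : (mu <= l)%N.
Proof. by rewrite leave_plen leq_addr. Qed.

Lemma leave_take i : (i <= mu)%N -> take i (parrows p) = nseq i g.
Proof.
case: shape => _ _ -> _ _ im; rewrite takel_cat ?size_nseq //.
by rewrite take_nseq.
Qed.

Lemma leave_nth_loop a i : (i < mu)%N -> nth a (parrows p) i = g.
Proof. by case: shape => _ _ -> _ _ im; rewrite nth_cat size_nseq im nth_nseq
  im. Qed.

Lemma leave_nth a i : nth a (parrows p) (mu + i) = nth a s i.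
Proof.
by case: shape => _ _ -> _ _; rewrite nth_cat size_nseq ltnNge leq_addr addKn.
Qed.

Lemma leave_pvertex_loop i : (i <= mu)%N -> pvertex p i = e.
Proof.
case: i => [|i] im; first exact: pvertex0.
rewrite (pvertexS g) ?(leq_trans im) ?leave_mu // leave_nth_loop //.
by case: shape.
Qed.

Lemma leave_pvertex i : (i < size s)%N ->
  pvertex p (mu + i).+1 = nth e (map (@tgt Q) s) i.
Proof.
move=> im; have il : (mu + i < l)%N by rewrite leave_plen ltn_add2l.
by rewrite (pvertexS g il) leave_nth (nth_map g).
Qed.

Lemma leave_pvertex_neq i : (mu < i <= l)%N -> pvertex p i <> e.
Proof.
case/andP=> mi il; have iE : i = (mu + (i - mu.+1)).+1 by rewrite -addSn subnKC.
have il' : (i - mu.+1 < size s)%N.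
  by rewrite -(ltn_add2l mu) -leave_plen -iE.
rewrite iE leave_pvertex // => ie; case: shape => _ _ _ /negP nin _; apply: nin.
by rewrite -/e -ie mem_nth ?size_map.
Qed.

(** The vertex [e_1] differs from [e], hence is not met in the loop part, and the last clause of the
    shape excludes it later on. So a detour along the leaving arrow has a single variable. *)
Lemma leave_head a i : ohead s = Some a -> (0 < mu)%N -> (i <= l)%N ->
  pvertex p i = tgt a -> i = mu.+1.
Proof.
case es: s => [|a0 s'] //= [ea]; subst a0 => mu0 il ia.
have i1 : pvertex p mu.+1 = tgt a.
  by have := @leave_pvertex 0; rewrite addn0 es => ->.
have [im|] := leqP i mu.
  case: (@leave_pvertex_neq mu.+1); first by rewrite leqnn leave_plen es /=
    addnS ltnS leq_addr.
  by rewrite i1 -ia leave_pvertex_loop.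
rewrite leq_eqVlt => /orP[/eqP <- //|mi].
have iE : i = (mu + (i - mu.+1)).+1 by rewrite -addSn subnKC // ltnW.
have il' : (i - mu.+1 < size s)%N by rewrite -(ltn_add2l mu) -leave_plen -iE.
case: shape => _ _ _ _ /(_ a s' es mu0).
have iS : (i - mu.+1 = (i - mu.+2).+1)%N by rewrite -subSn.
move: il'; rewrite es iS /= ltnS => il' /(_ (leq_ltn_trans (leq0n _) il'))
  /negP[].
have := @leave_pvertex (i - mu.+1); rewrite -iE es iS /= ltnS => /(_ il') ie.
by rewrite -ia ie mem_nth ?size_map.
Qed.

(* Elements of [e J^(mu + 1)] annihilate [x], since [p] does not return to [e]
   after [gamma^mu]. *)
Lemma leave_kill U (x : U) f : frame p x -> b_ (vpath e) * f = f ->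
  pow mu.+1 f ->
  act f x = 0.
Proof.
move=> fx ef hf; have [c [-> c0]] := frame_expand fx ef hf.
rewrite -(act0l x) -(prefix_comb0 K p); congr act; apply: eq_prefix_comb =>
  j jl.
apply: c0 => //; case: leqP => //= mj; apply/eqP/leave_pvertex_neq.
by rewrite mj.
Qed.

Lemma vpath_leave i : (i <= mu)%N -> b_ (vpath e) * b_ (ptake i p) = b_
  (ptake i p).
Proof. by move=> im; rewrite -(leave_pvertex_loop im) -pend_ptake bpath_pend.
  Qed.

Lemma leave_loop_kill U (x : U) i j : frame p x -> (i <= mu)%N -> (j <= mu)%N ->
  (mu < i + j)%N -> act (b_ (ptake i p) * b_ (ptake j p)) x = 0.
Proof.
move=> fx im jm mij; apply: (leave_kill fx); first by rewrite mulrA vpath_leave.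
apply: (arrow_pow_le mij); apply: arrow_powM; apply: arrow_powU;
  by rewrite plen_ptake // (leq_trans _ leave_mu).
Qed.

Lemma leave_loopM i j : (i + j <= mu)%N ->
  b_ (ptake i p) * b_ (ptake j p) = b_ (ptake (i + j) p).
Proof.
move=> ij; have im := leq_trans (leq_addr j i) ij; have jm :=
  leq_trans (leq_addl i j) ij.
apply: bpathM_cat => //; first by rewrite pend_ptake leave_pvertex_loop.
by rewrite /parrows /= -/(parrows p) !leave_take // -nseqD addnC.
Qed.

Section TopChange.
Variables (U : lmodType L) (x x' : U).
Hypotheses (fx : frame p x) (fx' : frame p x').

(* A second top element is [c_0 x + sum_(1 <= i <= mu) c_i gamma^i x]. *)
Lemma leave_top_change : exists c0 : K, c0 <> 0 /\
  forall D : nat -> K, (forall j, (j < mu)%N -> D j = 0) ->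
  act (prefix_comb p D) x' = act c0%:S (act (prefix_comb p D) x).
Proof.
have [c xc] : exists c, x' = act (prefix_comb p c) x by case: fx.
have ex' : act (b_ (vpath e)) x' = x' by case: fx'.
have cz j : (mu < j)%N -> (j <= l)%N -> c j = 0.
  move=> mj jl; apply: (frame_target (e := e) fx) => //; first by rewrite -xc.
  by apply: leave_pvertex_neq; rewrite mj.
have vj j : (mu <= j)%N -> (j <= l)%N ->
    act (b_ (ptake j p)) x' = act (c 0 *: b_ (ptake j p)) x.
  move=> mj jl; rewrite xc -actM /prefix_comb big_mkord mulr_sumr.
  rewrite act_suml (bigD1 ord0) //= big1 ?addr0.
    rewrite -pascalerAr ptake0 -[b_ (ptake j p) in RHS]bpath_pstart.
    by [].
  (* Terms with [i > mu] have coefficient 0; those with [0 < i <= mu] die because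
     [gamma^mu gamma^i x = 0]. *)
  move=> i i0; rewrite -pascalerAr actZl; have [im|mi] := leqP i mu; last first.
    by rewrite cz // ?scale0r ?act0l // -ltnS.
  rewrite -(bpath_psub K p mj) -mulrA actM leave_loop_kill ?act0r //.
  by rewrite -[X in (X < _)%N]addn0 ltn_add2l lt0n.
exists (c 0%N); split=> [c00|D D0].
  case: (fx') => _ px' _ _; apply: px'.
  by have := vj l leave_mu (leqnn l); rewrite ptake_plen c00 scale0r act0l.
rewrite -actZl /prefix_comb scaler_sumr !big_mkord !act_suml; apply: eq_bigr =>
  i _.
have [im|mi] := ltnP i mu; first by rewrite D0 // scale0r scaler0 !act0l.
have il : (i <= l)%N by rewrite -ltnS.
rewrite [LHS]actZl vj // -[LHS]actM -pascalerAl mul1r scalerA mulrC -scalerA.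
by [].
Qed.

(** Since [u] and the longer right subpaths have length at least [mu], both sides of the relation
    for the detour are multiplied by the same [c0] when [x] is replaced by [x']. *)
Lemma leave_invariant k k' (d : detour_index p) : realizes k x ->
  realizes k' x' ->
  (mu <= (val d).1.2)%N -> k d = k' d.
Proof.
move=> rx rx' md; have [c0 [c00 ch]] := leave_top_change.
have da := detour_dindex d; set a := darrow d in da; set u := dsub d in da.
have il : ((val d).1.2 <= l)%N by rewrite -ltnS.
have D0 (k0 : {ffun detour_index p -> K}) j : (j < mu)%N ->
  detour_coef k0 a u j = 0.
  by move=> jm; apply: detour_coef_out => //; rewrite (ltnW (leq_trans jm md)).
have eu : act (b_ (apath a) * b_ u) x' = act c0%:S (act (b_ (apath a) * b_ u)
  x).
  rewrite /u /dsub -(prefix_comb_delta K il) !(actM (b_ _)) ch.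
    by rewrite actZr -actZl.
  by move=> j jm; rewrite (ltn_eqF (leq_trans jm md)).
have : act c0%:S (act (prefix_comb p (fun j =>
  detour_coef k a u j - detour_coef k' a u j)) x) = 0.
  rewrite prefix_combB actBl actBr -(ch (detour_coef k' a u) (D0 k')).
  by rewrite -!detour_combE -rx // -rx' // eu subrr.
rewrite -actZl -prefix_combZ -(act0l x) -(prefix_comb0 K p) =>
  /(frame_uniq fx) h.
have jl : ((val d).2 <= l)%N by rewrite -ltnS.
have /eqP := h _ jl; rewrite mulf_eq0 => /orP[/eqP //|].
by rewrite /a /u !detour_coef_index subr_eq0 => /eqP.
Qed.

End TopChange.

(** The vectors [alpha gamma^i x] are made zero one at a time, from [i = mu - 1] down to 0, each
    time by a change of top element that spares those already treated. *)
Lemma leave_sweep U (x : U) : frame p x -> exists2 x' : U, frame p x' &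
  forall a i, ohead s = Some a -> (i < mu)%N ->
    act (b_ (apath a) * b_ (ptake i p)) x' = 0.
Proof.
move=> fx; case es: (ohead s) => [a|]; last by exists x.
suff H m : (m <= mu)%N -> exists2 x' : U, frame p x' &
    forall i, (mu - m <= i < mu)%N -> act (b_ (apath a) * b_ (ptake i p)) x' =
      0.
  have [x' fx' hx'] := H mu (leqnn mu); exists x' => // _ i [<-] im.
  by apply: hx'; rewrite subnn.
have al : (mu < l)%N by rewrite leave_plen -[X in (X < _)%N]addn0 ltn_add2l;
  case: s es.
have na : nth a (parrows p) mu = a.
  by rewrite -{1}[mu]addn0 leave_nth; case: s es => //= b t [].
have sa : src a = e by have := src_nth a al; rewrite na leave_pvertex_loop.
have amu : b_ (apath a) * b_ (ptake mu p) = b_ (ptake mu.+1 p).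
  by rewrite -(bpath_step K a al) na.
elim: m => [_|m IH mm].
  by exists x => // i; rewrite subn0 leqNgt andNb.
have [y fy hy] := IH (ltnW mm).
have mu0 : (0 < mu)%N by apply: leq_trans mm.
set i0 := (mu - m.+1)%N; have i0m : (i0 < mu)%N by rewrite /i0 -subn_gt0 subKn.
have i0E : (i0 + m.+1 = mu)%N by rewrite /i0 subnK.
have [||c [ec c0]] := @frame_expand _ _ _ _ _ _ fy (tgt a) i0.+1 (b_ (apath a)
  * b_ (ptake i0 p)).
- by rewrite mulrA; congr (_ * _); apply: (bpath_pend K (apath a)).
- rewrite -add1n; apply: arrow_powM; apply: arrow_powU; rewrite ?plen_ptake //.
  by rewrite (leq_trans (ltnW i0m)) ?leave_mu.
(* By [leave_head] only position [mu + 1] survives: [alpha gamma^i0 y] is a multiple of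
   [alpha gamma^mu y]. *)
have {}ec : act (b_ (apath a) * b_ (ptake i0 p)) y = act (c mu.+1 *:
  b_ (ptake mu.+1 p)) y.
  rewrite ec -(prefix_comb_delta K al) -prefix_combZ; congr act.
  apply: eq_prefix_comb => j jl; case: eqP => [->|jm]; first by rewrite mulr1.
  rewrite mulr0; apply: c0 => //; apply/orP; right; apply/eqP => ja; apply: jm.
  exact: (leave_head es mu0 jl ja).
set cc := c mu.+1 in ec.
(* As [i0 + (m + 1) = mu], subtracting [cc gamma^(m+1) y] cancels exactly [cc alpha gamma^mu y] at
   [i0]. *)
pose y' := act (1 - cc *: b_ (ptake m.+1 p)) y.
have yy' : y' = y - act (cc *: b_ (ptake m.+1 p)) y by rewrite /y' actBl act1.
have ty' : top_element y'.
  have [yn _] := frame_top_element adm fy; split.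
    apply: contra yn => y'1; rewrite -(subrK (act (cc *:
      b_ (ptake m.+1 p)) y) y) -yy' rpredD //.
    apply/(frame_radpow adm fy); eexists; last by
    []. by apply/arrow_powZ/arrow_powU; rewrite plen_ptake // (leq_trans mm
      leave_mu).
  exists e; rewrite -[RHS]/(act _ y') yy' actBr -actM -pascalerAr vpath_leave
    //.
  by case: (fy) => ->.
exists y'; first by apply: (mast_top_frame adm) => //;
  apply: (frame_mast adm fy).
move=> i /andP[i0i im]; rewrite yy' actBr -[X in _ - X]actM -pascalerAr -mulrA
  actZl.
move: i0i; rewrite -/i0 leq_eqVlt => /orP[/eqP <-|i0i].
  by rewrite leave_loopM i0E // amu ec -[X in _ - X]actZl subrr.
(* For [i > i0] the correction is invisible, because [gamma^(i + m + 1)] annihilates [y]. *)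
rewrite hy; last by rewrite im andbT /i0 -subSn // subSS in i0i *.
rewrite actM leave_loop_kill ?act0r ?subr0 // ?(ltnW im) //.
by rewrite -i0E ltn_add2r.
Qed.

Lemma leave_realizes U : mast_of p U -> exists (x : U) k, [/\ frame p x,
  realizes k x &
  forall d : detour_index p, ohead s = Some (darrow d) ->
    ((val d).1.2 < mu)%N -> k d = 0].
Proof.
move=> mU; have [x0 fx0] := mast_frame adm mU; have [x fx hx] :=
  leave_sweep fx0.
have [k rk] := frame_realizes fx; exists x, k; split=> // d sd dm.
have h := rk _ _ (detour_dindex d); move: h; rewrite hx // detour_combE.
rewrite -(act0l x) -(prefix_comb0 K p) => /(frame_uniq fx) h.
have jl : ((val d).2 <= l)%N by rewrite -ltnS.
by have := h _ jl; rewrite detour_coef_index.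
Qed.

End Leave.

Section LoopShape.
Hypothesis condN : conditionN I.

(** [mu] is the index of the first arrow other than [g]; (N) for [g] forbids a later return to [e],
    and (N) for the leaving arrow a later return to [e_1]. *)
Lemma loop_shape p g : mast I p -> src g = pstart p -> tgt g = pstart p ->
  exists mu s, loop_then_leave p g mu s.
Proof.
move=> mp sg tg; set e := pstart p; set l := plen p.
pose mu := find (predC1 g) (parrows p); pose s := drop mu (parrows p).
have ml : (mu <= l)%N by apply: find_size.
have tk : take mu (parrows p) = nseq mu g.
  apply: (@eq_from_nth _ g); first by rewrite size_takel // size_nseq.
  move=> i; rewrite size_takel // => im; rewrite nth_take // nth_nseq im.
  by have := before_find g im => /negbFE /eqP.
have hd a : (mu < l)%N -> nth a (parrows p) mu <> g.
  move=> ml'; rewrite (set_nth_default g) //.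
  have : has (predC1 g) (parrows p) by rewrite has_find.
  by move/(nth_find g) => /eqP.
have ap : parrows p = nseq mu g ++ s by rewrite -tk cat_take_drop.
have pv i : (i <= mu)%N -> pvertex p i = e.
  case: i => [|i] im; first exact: pvertex0.
  rewrite (pvertexS g) ?(leq_trans im) //.
  by rewrite ap nth_cat size_nseq im nth_nseq im.
have pn i : (mu < i)%N -> (i <= l)%N -> pvertex p i <> e.
  elim/ltn_ind: i => i IH mi il ie.
  have mul : (mu < l)%N := leq_trans mi il.
  (* The subpath from [mu] to [i] does not start with [g], so it ends with [g], and [p] is at [e]
     already at [i - 1]; induction descends to [mu]. *)
  have [//||h|h] := conditionN_nth adm condN (a := g) mp mi il.
  - by rewrite pv.
  - by rewrite ie.
  - exact: (hd g mul h).
  have i0 : i = i.-1.+1 by rewrite prednK // (leq_ltn_trans _ mi).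
  have il' : (i.-1 < l)%N by rewrite -i0.
  have sv := src_nth g il'; rewrite h sg in sv.
  move: mi; rewrite i0 ltnS leq_eqVlt => /orP[/eqP mE|mi].
    by apply: (hd g mul); rewrite mE.
  by apply: (IH i.-1) => //; [rewrite {2}i0|exact: ltnW].
have tn i : (i < size s)%N -> nth e (map (@tgt Q) s) i = pvertex p (mu + i).+1.
  move=> im; rewrite (nth_map g) // (pvertexS g);
    last by rewrite -ltn_subRL -size_drop.
  by rewrite nth_drop.
have sl i : (i < size s)%N -> (mu + i < l)%N by rewrite size_drop ltn_subRL.
exists mu, s; split=> //.
  apply/negP => /(nthP e) [i]; rewrite size_map => im; rewrite tn // => ie.
  by apply: (pn (mu + i).+1) => //; rewrite ?ltnS ?leq_addr // sl.
move=> a s' es mu0 s'0; apply/negP => /(nthP e) [i]; rewrite size_map => im ia.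
have i1 : (i.+1 < size s)%N by rewrite es.
have ia' : pvertex p (mu + i.+1).+1 = tgt a by rewrite -tn // es.
have ml' : (mu < l)%N by rewrite -subn_gt0 -size_drop -/s es.
have na b : nth b (parrows p) mu = a by rewrite -[mu]addn0 -nth_drop -/s es.
have sa : src a = e by have := src_nth a ml'; rewrite na pv.
(* The subpath starts one step early, with a loop, so that its first arrow is not [a]; its last
   arrow is then [a], which would bring [p] back to [e]. *)
have lt : (mu.-1 < (mu + i.+1).+1)%N by rewrite prednK // leqW // leq_addr.
have [//||h|h] := conditionN_nth adm condN (a := a) mp lt (sl _ i1).
- by rewrite pv // leq_pred.
- by rewrite ia'.
- apply: (hd a ml'); rewrite na -h ap nth_cat size_nseq prednK // leqnn
  nth_nseq prednK //.
  by rewrite leqnn.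
apply: (pn (mu + i.+1)%N).
- by rewrite -[X in (X < _)%N]addn0 ltn_add2l.
- exact/ltnW/sl.
by have := src_nth a (sl _ i1); rewrite /= in h; rewrite h sa => ->.
Qed.

(** By (N) the subpath of [p] from the end of [u] to a later visit of the target of [a] must end
    with [a]. This arrow starts at [e], so it is a loop or the leaving arrow, and the loop is ruled
    out because it is the next arrow after [u]. *)
Lemma detour_loop p g mu s a u : mast I p -> loop_then_leave p g mu s ->
  detour p a u -> (plen u < mu)%N ->
  [/\ ohead s = Some a, pstart u = pstart p & parrows u = nseq (plen u) g].
Proof.
move=> mp shape da um; have [ue ul sa] := detour_arrow da.
set i := plen u in um ue ul sa *.
have mul := leave_mu shape.
have il : (i < plen p)%N := leq_trans um mul.
(* Otherwise [a] after [u] would be a right subpath of [p], against the definition of a detour. *)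
have ni : nth a (parrows p) i <> a.
  move=> na; case/and3P: da => _; case E: Defs.pcomp => [w|//] /negP nw _;
    apply: nw.
  move/pcompP: E => [_ wE]; suff -> : w = ptake i.+1 p by
    apply: ptake_right_subpath.
  apply: qpath_eq; rewrite /pstart /parrows wE /=; first by rewrite ue.
  by rewrite -/(parrows p) -/(parrows u) {1}ue /parrows /= -/(parrows p)
    (take_nth a) // na cats1.
split; last by rewrite {1}ue [LHS]/parrows /= -/(parrows p) (leave_take shape)
  // ltnW.
  case/and3P: (da) => _ _ /existsP [j /andP[ij /eqP ja]].
  have jl : (j <= plen p)%N by rewrite -ltnS.
  have [//|||h] := conditionN_nth adm condN (a := a) mp ij jl => //.
  have j0 : (0 < j)%N := leq_ltn_trans (leq0n _) ij.
  have jl' : (j.-1 < plen p)%N by rewrite prednK.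
  have vj : pvertex p j.-1 = pstart p.
    by rewrite -(src_nth a jl') h sa (leave_pvertex_loop shape) // ltnW.
  have [jm|mj|jm] := ltngtP j.-1 mu.
  - by case: ni; rewrite -{2}h !(leave_nth_loop shape).
  - by case: (leave_pvertex_neq shape _ vj); rewrite mj ltnW.
  have s0 : (0 < size s)%N by rewrite -(ltn_add2l mu) addn0 -(leave_plen shape)
    -jm.
  have := leave_nth shape a 0; rewrite addn0 -jm h.
  by case: (s) s0 => //= b t _ <-.
by rewrite ue.
Qed.

End LoopShape.
End Shape.

(** * Finiteness, slackness and uniqueness *)

Section Main.
Variables (K : fieldType) (Q : quiver) (I : ideal (path_algebra K Q)).
Hypotheses (adm : admissible I) (condN : conditionN I).
Local Notation KQ := (path_algebra K Q).
Local Notation L := (Lambda I).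
Local Notation b_ := (bpath K).
Local Notation pow := (@arrow_ideal_pow K Q).
Implicit Types (U V W : lmodType L).

Lemma isomorphic_realizes p (k : {ffun detour_index p -> K}) U V (x : U) :
  isomorphic U V -> frame p x -> realizes k x ->
  exists y : V, frame p y /\ realizes k y.
Proof.
move=> [h [h' hK h'K]] [ex px gen kill] rx; exists (h x).
split; first split.
- by rewrite -act_lin ex.
- by move=> h0; apply: px; rewrite -[LHS]hK act_lin h0 -(linear0 h) hK.
- by move=> y; have [c yc] := gen (h' y); exists c; rewrite -act_lin -yc h'K.
- by move=> f hf y; rewrite -(h'K y) -act_lin kill // linear0.
by move=> a u da; rewrite -!act_lin rx.
Qed.

Variables (l : nat) (S : 'I_l.+1 -> lmodType L).
Hypothesis simS : forall i, simple (S i).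

Section Path.
Variable p : qpath Q.
Hypotheses (Sp : path_through S p) (mp : mast I p).

Lemma unique_path_through : unique (path_through S) p.
Proof. by split=> // q; apply: path_through_unique. Qed.

Lemma series_mast_through U : has_series S U -> mast_of p U.
Proof.
by move=> /(series_mast adm simS) [q Sq];
  rewrite (path_through_unique adm condN mp Sp Sq).
Qed.

Section Leave.
Variables (g : arrow Q) (mu : nat) (s : seq (arrow Q)).
Hypothesis shape : loop_then_leave p g mu s.

(* On an isomorphism type the coordinate [k d] is constant, so it takes at most
   [n] values. *)
Lemma finite_not_slack (d : detour_index p) : finitely_many_uniserials S ->
  (mu <= (val d).1.2)%N -> ~ slack_variable I d.
Proof.
move=> [n [M MP]] md /slack_variableP sd.
have H (m : 'I_n) : exists c : K, forall (k : {ffun detour_index p -> K}) (U :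
  lmodType L) (x : U),
    frame p x -> realizes k x -> isomorphic U (M m) -> k d = c.
  have [[k [U [x [fx rx iso]]]]|ne] := pselect (exists (k :
    {ffun detour_index p -> K}) (U : lmodType L) (x : U),
      [/\ frame p x, realizes k x & isomorphic U (M m)]); last first.
    (* No frame yields a module isomorphic to [M m], so any constant will do. *)
    by exists 0 => k U x fx rx iso; case: ne; exists k, U, x.
  exists (k d) => k' U' x' fx' rx' iso'.
  have [y [fy ry]] := isomorphic_realizes iso fx rx.
  have [y' [fy' ry']] := isomorphic_realizes iso' fx' rx'.
  exact: (leave_invariant shape fy' fy ry' ry md).
have [c cP] := choice H.
(* With one linear factor per listed module, this polynomial vanishes at every value of the
   coordinate. *)
have [|k /(VpP adm) [U [x [fx rx]]] fk] := sd (\prod_(m < n) ('X - (c m)%:P)).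
  by apply/prodf_neq0 => m _; rewrite polyXsubC_eq0.
apply: fk; have [m iso] := MP U (mast_series adm Sp (frame_mast adm fx)).
rewrite horner_prod (bigD1 m) //= hornerXsubC (cP m k U x) // subrr mul0r.
by [].
Qed.

(** Detours at [u] shorter than [mu] have the required form by [detour_loop]; the others are not
    slack by [finite_not_slack]. *)
Lemma finite_condition2 : finitely_many_uniserials S -> condition2 S.
Proof.
move=> fin; exists p; split; first exact: unique_path_through.
exists g, mu, s; split=> // a u [[da _] [d [[ea eu] sd]]].
have ud : plen u = (val d).1.2.
  by rewrite -eu plen_ptake // -ltnS.
have [um|mu_u] := ltnP (plen u) mu.
  by have [sa pu au] := detour_loop adm condN mp shape da um; exists (plen u).
by case: (finite_not_slack fin _ sd); rewrite -ud.
Qed.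

Hypothesis slack : forall a u, slack_halyard I p a u ->
  exists i, [/\ (i < mu)%N, ohead s = Some a,
    pstart u = pstart p & parrows u = nseq i g].

Lemma slack_halyard_swept (d : detour_index p) :
  slack_halyard I p (darrow d) (dsub d) ->
  ohead s = Some (darrow d) /\ ((val d).1.2 < mu)%N.
Proof.
move=> /slack [i [im sd _ ud]]; split=> //.
have <- : plen (dsub d) = (val d).1.2 by rewrite plen_ptake // -ltnS.
by rewrite /plen ud size_nseq.
Qed.

(** In the normal form of [leave_realizes] slack coordinates are 0 and the others are roots of fixed
    polynomials, so finitely many points suffice. *)
Lemma slack_finite : finitely_many_uniserials S.
Proof.
have H (d : detour_index p) : exists vs : seq K, forall k, Vp I k ->
    (ohead s = Some (darrow d) -> ((val d).1.2 < mu)%N -> k d = 0) ->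
      k d \in vs.
  have [sd|nsd] := pselect (slack_variable I d).
    exists [:: 0] => k _ h; have [sa dm] :=
      slack_halyard_swept (slack_variable_halyard sd).
    by rewrite inE h.
  have [f f0 fk] : exists2 f : {poly K}, f != 0 & forall k, Vp I k ->
    f.[k d] = 0.
    apply: contrapT => nf; apply: nsd; apply/slack_variableP => f f0.
    apply: contrapT => nk; apply: nf; exists f => // k Vk; apply: contrapT =>
      fk.
    by apply: nk; exists k.
  have [vs vsP] := poly_roots_seq f0; exists vs => k Vk _.
  by apply: vsP; apply/rootP/fk.
have [vs vsP] := choice H.
pose vals := flatten [seq vs d | d <- enum {: detour_index p}].
(* Points with coordinates in [vals] are coded by positions in this list, which makes [T] a finite
   type. *)
pose T := {ffun detour_index p -> 'I_(size vals)}.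
pose kt (t : T) : {ffun detour_index p -> K} := [ffun d => nth 0 vals (t d)].
have [U0 _] := mp.
have HM (i : 'I_#|T|) : exists M : lmodType L, forall U (x : U),
    frame p x -> realizes (kt (enum_val i)) x -> isomorphic U M.
  have [[M [y [fy ry]]]|ne] := pselect (exists (M : lmodType L) (y : M),
    frame p y /\ realizes (kt (enum_val i)) y).
    by exists M => U x fx rx; apply: (frame_iso fx fy rx ry).
  (* Codes realized by no module receive the dummy value [U0]. *)
  by exists U0 => U x fx rx; case: ne; exists U, x.
have [M MP] := choice HM.
exists #|T|, M => U /series_mast_through mU.
have [x [k [fx rx kz]]] := leave_realizes adm shape mU.
have kv d : k d \in vals.
  apply/flattenP; exists (vs d); first by apply: map_f; rewrite mem_enum.
  by apply: vsP => //; [apply/(VpP adm); exists U, x|exact: kz].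
have lt d : (index (k d) vals < size vals)%N by rewrite index_mem.
exists (enum_rank ([ffun d => Ordinal (lt d)] : T)); apply: (MP _ U x fx).
rewrite enum_rankK (_ : kt _ = k) //; apply/ffunP => d.
by rewrite !ffunE /= nth_index.
Qed.

(** In the normal form a nonzero coordinate would give a halyard, slack since none is tight, hence a
    swept one with coordinate 0. So every module belongs to the point 0. *)
Lemma no_tight_unique : (forall a u, ~ tight_halyard I p a u) ->
  unique_uniserial S.
Proof.
move=> nt.
pose z : {ffun detour_index p -> K} := [ffun=> 0].
have k0 (k : {ffun detour_index p -> K}) : Vp I k ->
    (forall d : detour_index p, ohead s = Some (darrow d) ->
      ((val d).1.2 < mu)%N -> k d = 0) ->
    k = z.
  move=> Vk kz; apply/ffunP => d; rewrite ffunE; apply: contrapT => kd.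
  have hd : halyard I p (darrow d) (dsub d).
    split; first exact: detour_dindex.
    by exists d; split=> // /coord_image_dvar /(_ k Vk).
  have : slack_halyard I p (darrow d) (dsub d).
    by apply: contrapT => ns; apply: (nt (darrow d) (dsub d)).
  by move=> /slack_halyard_swept [sd dm]; apply: kd; apply: kz.
have real U : mast_of p U -> exists2 x : U, frame p x & realizes z x.
  move=> mU; have [x [k [fx rx kz]]] := leave_realizes adm shape mU.
  exists x => //; rewrite -(k0 k) //; apply/(VpP adm).
  by exists U, x.
have [U0 mU0] := mp; exists U0; first exact: mast_series mU0.
move=> U /series_mast_through mU; have [x fx rx] := real U mU.
have [y fy ry] := real U0 mU0; exact: (frame_iso fx fy rx ry).
Qed.

End Leave.
End Path.
End Main.

Theorem theorem5p1 (K : fieldType) (Q : quiver) (I : ideal (path_algebra K Q))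
    (l : nat) (S : 'I_l.+1 -> lmodType (Lambda I)) :
  infinite_set [set: K]%classic ->
  admissible I ->
  conditionN I ->
  (forall i, simple (S i)) ->
  (VS S !=set0)%classic ->
  Ext1_neq0 (S ord0) (S ord0) ->
  (finitely_many_uniserials S <-> condition2 S) /\
  (condition2 S ->
   (forall p, path_through S p -> forall a u, ~ tight_halyard I p a u) ->
   unique_uniserial S).
Proof.
move=> _ adm condN simS [[p k] [/= Sp Vk]] ext.
have mp : mast I p by case: Vk => U [x [mU _ _]]; exists U.
split; last first.
  move=> [q [[Sq _] [g [mu [s [shape slack]]]]]] nt.
  (* By (N) the path of condition (2) is the one carrying the given point of [VS], hence a mast. *)
  have mq : mast I q by rewrite -(path_through_unique adm condN mp Sp Sq).
  exact: (no_tight_unique adm condN simS Sq mq shape slack (nt q Sq)).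
split=> [fin|[q [[Sq _] [g [mu [s [shape slack]]]]]]]; last first.
  have mq : mast I q by rewrite -(path_through_unique adm condN mp Sp Sq).
  exact: (slack_finite adm condN simS Sq mq shape slack).
(* The self-extension provides a loop at the start of [p], from which (N) yields the shape. *)
have [g sg tg] := Ext1_loop (path_through_vsimple adm ord0 Sp) ext.
have [mu [s shape]] := loop_shape adm condN mp (etrans sg (pvertex0 p))
  (etrans tg (pvertex0 p)).
exact: (finite_condition2 adm condN Sp mp shape fin).
Qed.
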